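(* Let $0\le k<1$ and let $f:\Delta\to\Delta$ be a $k$-quasiconformal homeomorphism of the unit disc $\Delta\subset\mathbb{C}$ onto itself. Then $f$ is a quasi-isometry of $(\Delta,d_\Delta)$, where $d_\Delta$ is the Poincaré distance on $\Delta$. That is, there exist constants $\lambda>0$ and $c>0$ such that for all $\zeta,\zeta'\in\Delta$, $$\frac1\lambda d_\Delta(\zeta,\zeta')-c\le d_\Delta(f(\zeta),f(\zeta'))\le\lambda d_\Delta(\zeta,\zeta')+c.$$
   Context: Let $\Omega$ be a domain in $\mathbb{C}$ and $k\ge0$. A map $f:\Omega\to\mathbb{C}$ of class $\mathcal{C}^1$ is called $k$-quasiconformal if for all $z\in\Omega$, $\left|\frac{\partial f}{\partial\bar\zeta}(z)\right|\le k\left|\frac{\partial f}{\partial\zeta}(z)\right|$. (No injectivity is required in this definition.) $\Delta=\{\zeta\in\mathbb{C}:|\zeta|<1\}$, and $d_\Delta$ is the Poincaré (hyperbolic) distance on $\Delta$, i.e. the distance induced by the metric $\frac{2|d\zeta|}{1-|\zeta|^2}$, for which $d_\Delta(0,r)=\log\frac{1+r}{1-r}$ for $0\le r<1$. The choice of normalization by a positive constant factor does not affect the statement. A map $f:(X,d)\to(X',d')$ between metric spaces is a quasi-isometry if there exist positive constants $\lambda$ and $c$ such that $\frac1\lambda d(x,y)-c\le d'(f(x),f(y))\le\lambda d(x,y)+c$ for all $x,y\in X$. *)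

(* Defs.v *)
From Stdlib Require Import Reals.
From Coquelicot Require Import Coquelicot.

Open Scope R_scope.

(* Maps defined on a subset of the plane are represented by total functions
   [C -> C]; every definition below only looks at their values on that subset
   (for derivatives, the subset is assumed to be open). *)

Definition unit_disc (z : C) : Prop := Cmod z < 1.

Definition re_part (f : C -> C) (z : C) : R := Re (f z).
Definition im_part (f : C -> C) (z : C) : R := Im (f z).

Definition ex_partials (u : C -> R) (z : C) : Prop :=
  ex_derive (fun x => u (x, Im z)) (Re z) /\
  ex_derive (fun y => u (Re z, y)) (Im z).

Definition partial_x (u : C -> R) (z : C) : R :=
  Derive (fun x => u (x, Im z)) (Re z).
Definition partial_y (u : C -> R) (z : C) : R :=
  Derive (fun y => u (Re z, y)) (Im z).

Definition C1_real_on (Omega : C -> Prop) (u : C -> R) : Prop :=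
  forall z : C, Omega z ->
    ex_partials u z /\ continuous (partial_x u) z /\ continuous (partial_y u) z.

Definition C1_on (Omega : C -> Prop) (f : C -> C) : Prop :=
  C1_real_on Omega (re_part f) /\ C1_real_on Omega (im_part f).

Definition Cpartial_x (f : C -> C) (z : C) : C :=
  (partial_x (re_part f) z, partial_x (im_part f) z).
Definition Cpartial_y (f : C -> C) (z : C) : C :=
  (partial_y (re_part f) z, partial_y (im_part f) z).

(* Wirtinger derivatives with respect to zeta and to its conjugate. *)
Definition d_zeta (f : C -> C) (z : C) : C :=
  ((Cpartial_x f z - Ci * Cpartial_y f z) / 2)%C.
Definition d_zetabar (f : C -> C) (z : C) : C :=
  ((Cpartial_x f z + Ci * Cpartial_y f z) / 2)%C.

Definition quasiconformal_on (Omega : C -> Prop) (k : R) (f : C -> C) : Prop :=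
  C1_on Omega f /\
  forall z : C, Omega z -> Cmod (d_zetabar f z) <= k * Cmod (d_zeta f z).

(* [continuous_on] is continuity for the subspace topology on its domain. *)
Definition homeomorphism_onto (D E : C -> Prop) (f : C -> C) : Prop :=
  (forall z : C, D z -> E (f z)) /\
  continuous_on D f /\
  exists g : C -> C,
    (forall w : C, E w -> D (g w)) /\
    continuous_on E g /\
    (forall z : C, D z -> g (f z) = z) /\
    (forall w : C, E w -> f (g w) = w).

Definition curve_velocity (gamma : R -> C) (t : R) : C :=
  (Derive (fun s => Re (gamma s)) t, Derive (fun s => Im (gamma s)) t).

(* The parameter interval is [0, 1].  Requiring [gamma] to be of class C^1 on
   the whole line loses nothing: a C^1 curve on a compact interval extends by
   its tangent lines.  Neither does excluding corners, since a piecewise C^1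
   curve can be reparametrized to stop at its corners, keeping its length. *)
Definition C1_curve (gamma : R -> C) : Prop :=
  forall t : R,
    ex_derive (fun s => Re (gamma s)) t /\
    ex_derive (fun s => Im (gamma s)) t /\
    continuous (curve_velocity gamma) t.

Definition C1_path_in_disc (z w : C) (gamma : R -> C) : Prop :=
  C1_curve gamma /\
  (forall t : R, 0 <= t <= 1 -> unit_disc (gamma t)) /\
  gamma 0 = z /\ gamma 1 = w.

(* Length for the metric 2 |d zeta| / (1 - |zeta|^2). *)
Definition poincare_length (gamma : R -> C) : R :=
  RInt (fun t => 2 * Cmod (curve_velocity gamma t) / (1 - Cmod (gamma t) ^ 2)) 0 1.

(* For [z] and [w] in the disc the set of lengths is nonempty (segments) and
   bounded below by 0, so its infimum is finite. *)
Definition poincare_dist (z w : C) : R :=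
  real (Glb_Rbar (fun l => exists gamma : R -> C,
    C1_path_in_disc z w gamma /\ l = poincare_length gamma)).

(* [f] is a quasi-isometry from the metric space [(D, d)] to [(Y, d')]. *)
Definition quasi_isometry_on {X Y : Type} (D : X -> Prop)
    (d : X -> X -> R) (d' : Y -> Y -> R) (f : X -> Y) : Prop :=
  exists lambda c : R, 0 < lambda /\ 0 < c /\
    forall x y : X, D x -> D y ->
      / lambda * d x y - c <= d' (f x) (f y) /\
      d' (f x) (f y) <= lambda * d x y + c.

(* Main.v *)
(* Write mu(z, w) = |z - w| / |1 - conj(z) w|; the Poincare distance is
   log ((1 + mu) / (1 - mu)).  By chaining along geodesics, it is enough to show
   that f and its inverse map pairs of points with mu <= eps to pairs with
   mu <= r < 1.  Composing with Moebius maps reduces this to F(0) = 0, and both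
   bounds follow from the length-area method:
   - if |w| is small and |F(w)| > 1/2, the images of all circles |x| = r with
     |w| <= r <= 1/2 surround the segment from 0 to F(w), hence are long;
   - if |F(w)| <= 1/2 and w is close to the unit circle, the circles centred at
     w / |w| with radius between 1 - |w| and 1 meet the preimage of the segment
     from F(w) to 0 and leave the disc, so |F| varies by at least 1/4 on each.
   In both cases quasiconformality bounds the sum of the squares of the lengths,
   over a logarithmic range of radii, by the area of the unit disc.  To avoid a
   change of variables, this is done on a polar grid: the image of the disc
   around each grid point contains a square of comparable size, and disjoint
   squares are compared with the area of [-1, 1] x [-1, 1]. *)

Require Import Defs.
From Stdlib Require Import Reals Ranalysis5 Lra Lia List FinFun Classical ClassicalEpsilon.
From Coquelicot Require Import Coquelicot.

Open Scope R_scope.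

(** * Moebius maps of the disc *)

(** The two local estimates do not follow from each other by exchanging f with its inverse: the
    differential of f may vanish, as that of z |z|^2 does at 0, and then the inverse is not of class
    C^1. Hence both are proved for f itself: one controls the images of close points, the other the
    distance of points with close images. Of the inverse only continuity is used. Critical points
    also shape [locally_qc], a two-point estimate with a stretch factor that may be 0 and an
    additive error eps. It passes through compositions with Moebius maps without computing
    derivatives and, by compactness, holds at one common scale on smaller closed discs. The price is
    that its lower bound is empty where the stretch is of order eps. The length-area sum treats such
    grid points apart: eps is fixed before the mesh, small enough for their total contribution to be
    bounded whatever the mesh. The constant (1 - k) / (1 + k) bounds from below the ratio of the
    smallest to the largest stretch of the differential. The radii of the grid grow by the factor 1
    + 1/N while the angles advance by 2 PI / N, so that cells have comparable sides at every
    scale. *)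

Lemma Cmod_sq (z : C) : Cmod z ^ 2 = Re z ^ 2 + Im z ^ 2.
Proof.
unfold Cmod, Re, Im. rewrite pow2_sqrt; [reflexivity|nra].
Qed.

Lemma Cmod_minus_sym (z w : C) : Cmod (z - w) = Cmod (w - z).
Proof. rewrite <- Cmod_opp. f_equal. ring. Qed.

Lemma Cmod_sub_triangle (x y z : C) : Cmod (x - z) <= Cmod (x - y) + Cmod (y - z).
Proof. replace (x - z)%C with ((x - y) + (y - z))%C by ring. apply Cmod_triangle. Qed.

Lemma Cmod_le_sub (x y : C) : Cmod x <= Cmod y + Cmod (x - y).
Proof. replace x with (y + (x - y))%C at 1 by ring. apply Cmod_triangle. Qed.

Lemma Cmod_le_Rabs_sum (z : C) : Cmod z <= Rabs (Re z) + Rabs (Im z).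
Proof.
pose proof (Rabs_pos (Re z)). pose proof (Rabs_pos (Im z)).
pose proof (Cmod_sq z) as h. rewrite <- (pow2_abs (Re z)), <- (pow2_abs (Im z)) in h.
pose proof (Cmod_ge_0 z). nra.
Qed.

Lemma Rabs_Re_le (z : C) : Rabs (Re z) <= Cmod z.
Proof.
eapply Rle_trans; [|apply Rmax_Cmod]. apply Rmax_l.
Qed.

Lemma Rabs_Im_le (z : C) : Rabs (Im z) <= Cmod z.
Proof.
eapply Rle_trans; [|apply Rmax_Cmod]. apply Rmax_r.
Qed.

Lemma pow2_lt_reg (x y : R) : 0 <= y -> x ^ 2 < y ^ 2 -> x < y.
Proof. nra. Qed.

Definition moebius (b z : C) : C := ((z - b) / (1 - Cconj b * z))%C.

Definition pseudo_dist (z w : C) : R := Cmod (moebius z w).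

Lemma moebius_den_lower (b z : C) : 1 - Cmod b * Cmod z <= Cmod (1 - Cconj b * z).
Proof.
pose proof (Cmod_le_sub 1 (1 - Cconj b * z)) as h.
replace (1 - (1 - Cconj b * z))%C with (Cconj b * z)%C in h by ring.
rewrite Cmod_mult, Cmod_conj, Cmod_1 in h. lra.
Qed.

Lemma moebius_den_pos (b z : C) : unit_disc b -> unit_disc z ->
  0 < Cmod (1 - Cconj b * z).
Proof.
unfold unit_disc. intros hb hz. pose proof (moebius_den_lower b z).
pose proof (Cmod_ge_0 b). pose proof (Cmod_ge_0 z). nra.
Qed.

Lemma moebius_den_neq0 (b z : C) : unit_disc b -> unit_disc z ->
  (1 - Cconj b * z)%C <> 0%C.
Proof.
intros hb hz. apply Cmod_gt_0. now apply moebius_den_pos.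
Qed.

(** Divided by |1 - conj(b) z|^2, this identity computes 1 - mu^2, the source of all metric
    properties of [moebius] below. *)
Lemma moebius_den_sq (b z : C) :
  Cmod (1 - Cconj b * z) ^ 2 - Cmod (z - b) ^ 2 = (1 - Cmod b ^ 2) * (1 - Cmod z ^ 2).
Proof.
rewrite !Cmod_sq. destruct b as [b1 b2], z as [x y]. cbn. ring.
Qed.

Lemma one_minus_pseudo_dist_sq (b z : C) : unit_disc b -> unit_disc z ->
  (1 - pseudo_dist b z ^ 2) * Cmod (1 - Cconj b * z) ^ 2
  = (1 - Cmod b ^ 2) * (1 - Cmod z ^ 2).
Proof.
intros hb hz. pose proof (moebius_den_pos b z hb hz) as h0.
rewrite <- moebius_den_sq. unfold pseudo_dist, moebius.
rewrite Cmod_div by now apply moebius_den_neq0.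
field. lra.
Qed.

Lemma one_minus_sq_pos (z : C) : unit_disc z -> 0 < 1 - Cmod z ^ 2.
Proof. unfold unit_disc. pose proof (Cmod_ge_0 z). nra. Qed.

Lemma moebius_disc (b z : C) : unit_disc b -> unit_disc z -> unit_disc (moebius b z).
Proof.
intros hb hz. pose proof (moebius_den_pos b z hb hz) as h0.
pose proof (one_minus_pseudo_dist_sq b z hb hz) as h1.
pose proof (one_minus_sq_pos b hb). pose proof (one_minus_sq_pos z hz).
unfold pseudo_dist in h1. unfold unit_disc.
pose proof (Cmod_ge_0 (moebius b z)).
assert (0 < 1 - Cmod (moebius b z) ^ 2) by nra. nra.
Qed.

Lemma unit_disc_opp (b : C) : unit_disc b -> unit_disc (- b).
Proof. unfold unit_disc. now rewrite Cmod_opp. Qed.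

Lemma unit_disc_0 : unit_disc 0.
Proof. unfold unit_disc. rewrite Cmod_0. lra. Qed.

Lemma Cmod_sq_C (b : C) : RtoC (Cmod b ^ 2) = (Cconj b * b)%C.
Proof.
rewrite Cmod_sq. destruct b as [x y]. unfold Cconj, RtoC, Cmult. cbn.
f_equal; ring.
Qed.

Lemma one_minus_sq_neq0 (b : C) : unit_disc b -> (1 - Cconj b * b)%C <> 0%C.
Proof. intros hb. now apply moebius_den_neq0. Qed.

Lemma moebius_sub (b z w : C) : unit_disc b -> unit_disc z -> unit_disc w ->
  (moebius b z - moebius b w)%C =
  ((z - w) * (1 - Cconj b * b) / ((1 - Cconj b * z) * (1 - Cconj b * w)))%C.
Proof.
intros hb hz hw. unfold moebius. field.
split; now apply moebius_den_neq0.
Qed.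

Lemma moebiusK (b z : C) : unit_disc b -> unit_disc z ->
  moebius (- b) (moebius b z) = z.
Proof.
intros hb hz. unfold moebius. rewrite Copp_conj. field. split.
- now apply moebius_den_neq0.
- intros h. apply (one_minus_sq_neq0 b hb). rewrite <- h. ring.
Qed.

Lemma moebiusKV (b z : C) : unit_disc b -> unit_disc z ->
  moebius b (moebius (- b) z) = z.
Proof.
intros hb hz. replace b with (- - b)%C at 1 by ring.
apply moebiusK; auto using unit_disc_opp.
Qed.

Lemma moebius_self (b : C) : moebius b b = 0%C.
Proof. unfold moebius, Cdiv. ring. Qed.

Lemma moebius_opp_0 (b : C) : moebius (- b) 0 = b.
Proof.
unfold moebius. rewrite Cmult_0_r. field.
Qed.

Lemma pseudo_dist_moebius (b z w : C) : unit_disc b -> unit_disc z -> unit_disc w ->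
  pseudo_dist (moebius b z) (moebius b w) = pseudo_dist z w.
Proof.
intros hb hz hw. unfold pseudo_dist. unfold moebius at 1.
rewrite moebius_sub by assumption.
assert (hbz := moebius_den_neq0 b z hb hz).
assert (hbw := moebius_den_neq0 b w hb hw).
assert (hzw := moebius_den_neq0 z w hz hw).
assert (hzb := moebius_den_neq0 z b hz hb).
assert (hbb := one_minus_sq_neq0 b hb).
assert (e : Cconj (moebius b z) = ((Cconj z - Cconj b) / (1 - b * Cconj z))%C).
{ unfold moebius. rewrite Cdiv_conj, !Cminus_conj, Cmult_conj, Cconj_conj; [|assumption].
  f_equal. f_equal. unfold Cconj, RtoC. cbn. f_equal. ring. }
rewrite e. unfold moebius.
assert (hzb' : (1 - b * Cconj z)%C <> 0%C) by (rewrite Cmult_comm; exact hzb).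
(* The last factor of the new expression is a quotient of two conjugate numbers, hence of modulus
   1. *)
replace ((w - z) * (1 - Cconj b * b) / ((1 - Cconj b * w) * (1 - Cconj b * z)) /
    (1 - (Cconj z - Cconj b) / (1 - b * Cconj z) * ((w - b) / (1 - Cconj b * w))))%C
 with ((w - z) / (1 - Cconj z * w) * ((1 - b * Cconj z) / (1 - Cconj b * z)))%C.
- rewrite Cmod_mult. replace (Cmod ((1 - b * Cconj z) / (1 - Cconj b * z))) with 1; [ring|].
  rewrite Cmod_div by assumption.
  rewrite <- (Cmod_conj (1 - b * Cconj z)), Cminus_conj, Cmult_conj, Cconj_conj.
  replace (Cconj 1) with (RtoC 1) by (unfold Cconj, RtoC; cbn; f_equal; ring).
  field. apply Rgt_not_eq. now apply moebius_den_pos.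
- field. repeat split; try assumption.
  replace ((1 - b * Cconj z) * (1 - Cconj b * w) - (Cconj z - Cconj b) * (w - b))%C
   with ((1 - Cconj b * b) * (1 - Cconj z * w))%C by ring.
  now apply Cmult_neq_0.
Qed.

Lemma pseudo_dist_lt1 (z w : C) : unit_disc z -> unit_disc w -> pseudo_dist z w < 1.
Proof. exact (moebius_disc z w). Qed.

Lemma Cminus_0_r (z : C) : (z - 0)%C = z.
Proof. ring. Qed.

Lemma RtoC_neq0 (s : R) : s <> 0 -> RtoC s <> 0%C.
Proof. intros hs h. apply hs. now apply (f_equal Re) in h. Qed.

(** * Coarse Lipschitz maps *)

Definition disc_dist (z w : C) : R := ln ((1 + pseudo_dist z w) / (1 - pseudo_dist z w)).

Lemma pseudo_dist_ge0 (z w : C) : 0 <= pseudo_dist z w.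
Proof. apply Cmod_ge_0. Qed.

Lemma pseudo_dist_self (z : C) : pseudo_dist z z = 0.
Proof. unfold pseudo_dist. now rewrite moebius_self, Cmod_0. Qed.

Lemma pseudo_dist_eq0 (z w : C) : unit_disc z -> unit_disc w -> pseudo_dist z w = 0 -> w = z.
Proof.
intros hz hw h. apply Cmod_eq_0 in h.
now rewrite <- (moebiusK z w), h, moebius_opp_0 by assumption.
Qed.

Lemma exp_disc_dist (z w : C) : unit_disc z -> unit_disc w ->
  exp (disc_dist z w) = (1 + pseudo_dist z w) / (1 - pseudo_dist z w).
Proof.
intros hz hw. apply exp_ln. pose proof (pseudo_dist_lt1 z w hz hw).
pose proof (pseudo_dist_ge0 z w). apply Rdiv_lt_0_compat; lra.
Qed.

Lemma disc_dist_ge0 (z w : C) : unit_disc z -> unit_disc w -> 0 <= disc_dist z w.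
Proof.
intros hz hw. unfold disc_dist. rewrite <- ln_1. pose proof (pseudo_dist_lt1 z w hz hw).
pose proof (pseudo_dist_ge0 z w). apply ln_le; [lra|]. apply Rle_div_r; lra.
Qed.

(** In the formula for 1 - mu^2, bounding |1 - conj(x) y| below by 1 - |x| lets one factor 1 - |x|
    cancel. A factor 2 is lost in 1 + |x| <= 2 and another in 1 - |x|^2 <= 2 (1 - |x|), hence the
    4. *)
Lemma one_minus_sq_contraction (x y : C) (r : R) : unit_disc x -> unit_disc y ->
  0 <= r < 1 -> pseudo_dist x y <= r ->
  (1 - r ^ 2) / 4 * (1 - Cmod x ^ 2) <= 1 - Cmod y ^ 2.
Proof.
intros hx hy hr h. pose proof (one_minus_pseudo_dist_sq x y hx hy) as e.
pose proof (pseudo_dist_ge0 x y) as h0.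
pose proof (moebius_den_lower x y) as h1.
unfold unit_disc in *. pose proof (Cmod_ge_0 x). pose proof (Cmod_ge_0 y).
set (a := Cmod x) in *. set (b := Cmod y) in *. set (n := Cmod (1 - Cconj x * y)) in *.
assert (hn : 1 - a <= n) by nra.
assert (h2 : (1 - r ^ 2) * (1 - a) ^ 2 <= (1 - a ^ 2) * (1 - b ^ 2)).
{ rewrite <- e. apply Rmult_le_compat; [nra|nra|nra|apply pow_incr; lra]. }
assert (h3 : (1 - r ^ 2) * (1 - a) <= (1 + a) * (1 - b ^ 2)).
{ apply (Rmult_le_reg_l (1 - a)); [lra|]. nra. }
assert (0 <= (1 - r ^ 2) * (1 - a)) by (apply Rmult_le_pos; nra).
assert (0 <= 1 - b ^ 2) by nra. nra.
Qed.

(** A substitute for the triangle inequality of the hyperbolic distance d: since 1 - mu^2 lies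
    between exp(-d) and 4 exp(-d), a factor lost here is a bounded increase of d. *)
Lemma pseudo_dist_contraction (z x y : C) (r : R) :
  unit_disc z -> unit_disc x -> unit_disc y -> 0 <= r < 1 -> pseudo_dist x y <= r ->
  (1 - r ^ 2) / 4 * (1 - pseudo_dist z x ^ 2) <= 1 - pseudo_dist z y ^ 2.
Proof.
intros hz hx hy hr h. unfold pseudo_dist.
apply (one_minus_sq_contraction (moebius z x) (moebius z y) r); auto using moebius_disc.
now rewrite pseudo_dist_moebius.
Qed.

Lemma pseudo_dist_radial (z : C) (s : R) : unit_disc z -> 0 <= s <= 1 ->
  pseudo_dist (s * z) z = (1 - s) * Cmod z / (1 - s * Cmod z ^ 2).
Proof.
intros hz hs. unfold pseudo_dist, moebius.
pose proof (one_minus_sq_pos z hz) as h1.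
assert (e : (1 - Cconj (s * z) * z)%C = RtoC (1 - s * Cmod z ^ 2)).
{ rewrite RtoC_minus, RtoC_mult, Cmod_sq_C, Cmult_conj.
  replace (Cconj s) with (RtoC s); [ring|]. unfold Cconj, RtoC. cbn. f_equal. ring. }
pose proof (pow2_ge_0 (Cmod z)).
assert (h2 : 0 < 1 - s * Cmod z ^ 2) by nra.
rewrite e, Cmod_div by (apply RtoC_neq0; lra).
replace (z - s * z)%C with ((1 - s)%R * z)%C by (rewrite RtoC_minus; ring).
rewrite Cmod_mult, !Cmod_R, !Rabs_pos_eq by lra. reflexivity.
Qed.

(** As (1 + mu) / (1 - mu) is the exponential of the distance, the equation says that distances add
    up along the geodesic. Once [z] is moved to 0 the geodesic is a radius, and the modulus [rho']
    comes from the subtraction formula of the hyperbolic tangent. *)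
Lemma geodesic_step (z w : C) (eps : R) : unit_disc z -> unit_disc w -> 0 < eps < 1 ->
  eps < pseudo_dist z w -> exists w', unit_disc w' /\ pseudo_dist w' w = eps /\
   (1 + pseudo_dist z w') / (1 - pseudo_dist z w') * ((1 + eps) / (1 - eps)) =
   (1 + pseudo_dist z w) / (1 - pseudo_dist z w).
Proof.
intros hz hw heps hlt. set (rho := pseudo_dist z w) in *.
assert (hrho : rho < 1) by now apply pseudo_dist_lt1.
set (rho' := (rho - eps) / (1 - eps * rho)).
assert (h0 : 0 < 1 - eps * rho) by nra.
assert (h1 : 0 < rho') by (apply Rdiv_lt_0_compat; lra).
assert (h2 : rho' < rho).
{ apply Rlt_div_l; [lra|]. assert (eps * rho ^ 2 < eps * 1) by (apply Rmult_lt_compat_l; nra). nra. }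
set (s := rho' / rho).
assert (hs : 0 <= s <= 1).
{ split; [apply Rdiv_le_0_compat; lra|]. unfold s. apply Rle_div_l; lra. }
set (W := moebius z w). assert (hWd : unit_disc W) by now apply moebius_disc.
assert (hW : Cmod W = rho) by reflexivity.
assert (hX : Cmod (s * W)%C = rho').
{ rewrite Cmod_mult, Cmod_R, hW, Rabs_pos_eq by lra. unfold s. field. lra. }
assert (hXd : unit_disc (s * W)%C) by (unfold unit_disc; lra).
exists (moebius (- z) (s * W)%C).
assert (hw' : unit_disc (moebius (- z) (s * W)%C)) by (apply moebius_disc; auto using unit_disc_opp).
split; [assumption|]. split.
- rewrite <- (pseudo_dist_moebius z) by assumption. rewrite moebiusKV by assumption.
  fold W. rewrite pseudo_dist_radial, hW by assumption. unfold s, rho'. field.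
  repeat split; nra.
- replace (pseudo_dist z (moebius (- z) (s * W)%C)) with rho'.
  + unfold rho'. field. repeat split; nra.
  + unfold pseudo_dist. rewrite moebiusKV by assumption. now symmetry.
Qed.

(** Each step of the chain costs one factor [(1 - r ^ 2) / 4]. For [n = 0] the hypothesis forces
    [z = w]; a remainder of size at most [eps] is covered by a single factor. *)
Lemma chain_bound (phi : C -> C) (eps r : R) (n : nat) : 0 < eps < 1 -> 0 <= r < 1 ->
  (forall z, unit_disc z -> unit_disc (phi z)) ->
  (forall z w, unit_disc z -> unit_disc w -> pseudo_dist z w <= eps ->
     pseudo_dist (phi z) (phi w) <= r) ->
  forall z w, unit_disc z -> unit_disc w ->
  (1 + pseudo_dist z w) / (1 - pseudo_dist z w) <= ((1 + eps) / (1 - eps)) ^ n ->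
  ((1 - r ^ 2) / 4) ^ n <= 1 - pseudo_dist (phi z) (phi w) ^ 2.
Proof.
intros heps hr hphi hloc. assert (hc : 0 < (1 - r ^ 2) / 4 <= 1) by nra.
induction n as [|n IH]; intros z w hz hw h.
- pose proof (pseudo_dist_lt1 z w hz hw). pose proof (pseudo_dist_ge0 z w).
  cbn [pow] in *. apply Rle_div_l in h; [|lra].
  rewrite (pseudo_dist_eq0 z w) by (auto; lra). rewrite pseudo_dist_self. lra.
- destruct (Rle_dec (pseudo_dist z w) eps) as [he|he].
  + pose proof (hloc z w hz hw he). pose proof (pseudo_dist_ge0 (phi z) (phi w)).
    assert (((1 - r ^ 2) / 4) ^ n <= 1).
    { eapply Rle_trans; [apply pow_incr; split; [|apply hc]; lra|]. rewrite pow1. lra. }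
    rewrite <- tech_pow_Rmult. apply (Rle_trans _ ((1 - r ^ 2) / 4 * 1)); [apply Rmult_le_compat_l; lra|nra].
  + destruct (geodesic_step z w eps) as (w' & hw' & hd & e); auto; [lra|].
    rewrite <- tech_pow_Rmult. eapply Rle_trans; [|apply (pseudo_dist_contraction (phi z) (phi w') (phi w) r); auto].
    * apply Rmult_le_compat_l; [lra|]. apply IH; auto.
      rewrite <- e in h. rewrite <- tech_pow_Rmult in h. rewrite (Rmult_comm (_ / _)) in h.
      apply Rmult_le_reg_l in h; [assumption|]. apply Rdiv_lt_0_compat; lra.
    * apply hloc; auto. lra.
Qed.

Lemma coarse_lipschitz (phi : C -> C) (eps r : R) : 0 < eps < 1 -> 0 <= r < 1 ->
  (forall z, unit_disc z -> unit_disc (phi z)) ->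
  (forall z w, unit_disc z -> unit_disc w -> pseudo_dist z w <= eps ->
     pseudo_dist (phi z) (phi w) <= r) ->
  exists lam c, 0 < lam /\ 0 < c /\ forall z w, unit_disc z -> unit_disc w ->
    disc_dist (phi z) (phi w) <= lam * disc_dist z w + c.
Proof.
intros heps hr hphi hloc.
set (b := (1 + eps) / (1 - eps)). set (c := (1 - r ^ 2) / 4).
assert (hb : 1 < b) by (apply Rlt_div_r; lra).
assert (hc : 0 < c < 1) by (unfold c; nra).
assert (hlb : 0 < ln b) by (rewrite <- ln_1; apply ln_increasing; lra).
assert (hlc : 0 < - ln c).
{ pose proof (ln_increasing c 1 ltac:(lra) ltac:(lra)) as h. rewrite ln_1 in h. lra. }
assert (hl4 : 0 < ln 4) by (rewrite <- ln_1; apply ln_increasing; lra).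
(* A step of length [ln b] costs [- ln c], and rounding up the number of steps costs [- ln c] once
   more. The [ln 4] comes from (1 + d) / (1 - d) = (1 + d)^2 / (1 - d^2) <= 4 / (1 - d^2). *)
exists (- ln c / ln b), (ln 4 - ln c). split; [now apply Rdiv_lt_0_compat|]. split; [lra|].
intros z w hz hw. pose proof (disc_dist_ge0 z w hz hw) as h0.
destruct (nfloor_ex (disc_dist z w / ln b)) as (n & hn1 & hn2).
{ now apply Rdiv_le_0_compat. }
assert (hch := chain_bound phi eps r (S n) heps hr hphi hloc z w hz hw). fold b c in hch.
assert (hpw : forall x m, 0 < x -> x ^ m = exp (INR m * ln x)).
{ intros x m hx. rewrite <- Rpower_pow by assumption. reflexivity. }
rewrite !hpw, <- exp_disc_dist, S_INR in hch by (auto; lra).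
assert (h1 : disc_dist z w <= (INR n + 1) * ln b).
{ apply Rlt_le, Rlt_div_l; lra. }
assert (h1' : exp (disc_dist z w) <= exp ((INR n + 1) * ln b)).
{ destruct h1 as [h1|h1]; [left; now apply exp_increasing|right; now rewrite h1]. }
specialize (hch h1').
set (d := pseudo_dist (phi z) (phi w)) in *.
assert (hd0 : 0 <= d) by apply pseudo_dist_ge0.
assert (hd1 : d < 1) by (apply pseudo_dist_lt1; auto).
assert (h2 : disc_dist (phi z) (phi w) <= ln 4 - (INR n + 1) * ln c).
{ unfold disc_dist. fold d. rewrite <- (ln_exp (ln 4 - (INR n + 1) * ln c)).
  apply ln_le; [apply Rdiv_lt_0_compat; lra|].
  unfold Rminus at 2. rewrite exp_plus, exp_ln, exp_Ropp by lra.
  set (E := exp ((INR n + 1) * ln c)) in *. assert (hE : 0 < E) by apply exp_pos.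
  apply (Rmult_le_reg_r E); [assumption|].
  rewrite Rmult_assoc, Rinv_l, Rmult_1_r by lra.
  apply (Rle_trans _ ((1 + d) / (1 - d) * (1 - d ^ 2))).
  - apply Rmult_le_compat_l; [apply Rdiv_le_0_compat; lra|assumption].
  - replace ((1 + d) / (1 - d) * (1 - d ^ 2)) with ((1 + d) ^ 2) by (field; lra). nra. }
replace (- ln c / ln b * disc_dist z w) with (- ln c * (disc_dist z w / ln b)) by (field; lra).
nra.
Qed.

(** * The Poincare distance *)

Definition is_derive_C (psi : R -> C) (t : R) (v : C) : Prop :=
  is_derive (fun s => Re (psi s)) t (Re v) /\ is_derive (fun s => Im (psi s)) t (Im v).

Definition continuous_C (psi : R -> C) (t : R) : Prop :=
  continuous (fun s => Re (psi s)) t /\ continuous (fun s => Im (psi s)) t.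

Lemma is_derive_C_eq (psi : R -> C) (t : R) (v w : C) :
  is_derive_C psi t v -> v = w -> is_derive_C psi t w.
Proof. now intros h <-. Qed.

Lemma is_derive_C_const (c : C) (t : R) : is_derive_C (fun _ => c) t 0.
Proof. split; apply (is_derive_const (V := R_NormedModule)). Qed.

Lemma is_derive_C_minus (f g : R -> C) (t : R) (a b : C) :
  is_derive_C f t a -> is_derive_C g t b -> is_derive_C (fun s => f s - g s)%C t (a - b)%C.
Proof.
intros [h1 h2] [h3 h4]. split.
- exact (is_derive_minus (V := R_NormedModule) _ _ _ _ _ h1 h3).
- exact (is_derive_minus (V := R_NormedModule) _ _ _ _ _ h2 h4).
Qed.

Lemma is_derive_C_mult (f g : R -> C) (t : R) (a b : C) :
  is_derive_C f t a -> is_derive_C g t b ->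
  is_derive_C (fun s => f s * g s)%C t (a * g t + f t * b)%C.
Proof.
intros [h1 h2] [h3 h4]. split.
- replace (Re (a * g t + f t * b)) with
    ((Re a * Re (g t) + Re (f t) * Re b) - (Im a * Im (g t) + Im (f t) * Im b))
    by (unfold Re, Im; cbn; ring).
  apply (is_derive_minus (V := R_NormedModule)).
  + exact (is_derive_mult _ _ _ _ _ h1 h3 Rmult_comm).
  + exact (is_derive_mult _ _ _ _ _ h2 h4 Rmult_comm).
- replace (Im (a * g t + f t * b)) with
    ((Re a * Im (g t) + Re (f t) * Im b) + (Im a * Re (g t) + Im (f t) * Re b))
    by (unfold Re, Im; cbn; ring).
  apply (is_derive_plus (V := R_NormedModule)).
  + exact (is_derive_mult _ _ _ _ _ h1 h4 Rmult_comm).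
  + exact (is_derive_mult _ _ _ _ _ h2 h3 Rmult_comm).
Qed.

Lemma Csq_neq0 (z : C) : z <> 0%C -> Re z ^ 2 + Im z ^ 2 <> 0.
Proof.
intros hz h. apply Cmod_gt_0 in hz. rewrite <- Cmod_sq in h. nra.
Qed.

Lemma Cinv_mult_self (z : C) : z <> 0%C ->
  (/ (z * z))%C = ((Re z ^ 2 - Im z ^ 2) / (Re z ^ 2 + Im z ^ 2) ^ 2,
                   - 2 * Re z * Im z / (Re z ^ 2 + Im z ^ 2) ^ 2).
Proof.
intros hz. pose proof (Csq_neq0 z hz) as h. destruct z as [x y]. cbn [Re Im fst snd] in *.
replace (/ ((x, y) * (x, y)))%C with (/ (x, y) * / (x, y))%C by (field; assumption).
unfold Cinv, Cmult. cbn [fst snd]. f_equal; field; nra.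
Qed.

(** Serves both components of an inverse: the imaginary part of 1 / (X + iY) is, up to sign, the
    same quotient with [X] and [Y] exchanged. *)
Lemma is_derive_quot_sq (X Y : R -> R) (t x y : R) : X t ^ 2 + Y t ^ 2 <> 0 ->
  is_derive X t x -> is_derive Y t y ->
  is_derive (fun s => X s / (X s ^ 2 + Y s ^ 2)) t
   ((x * (Y t ^ 2 - X t ^ 2) - 2 * X t * Y t * y) / (X t ^ 2 + Y t ^ 2) ^ 2).
Proof.
intros h0 h1 h2.
assert (e1 := is_derive_unique _ _ _ h1). assert (e2 := is_derive_unique _ _ _ h2).
assert (ex_derive X t) by (eexists; exact h1). assert (ex_derive Y t) by (eexists; exact h2).
auto_derive; [repeat split; assumption|].
change (fun s : R => X s) with X. change (fun s : R => Y s) with Y.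
rewrite e1, e2. field. assumption.
Qed.

Lemma is_derive_C_inv (f : R -> C) (t : R) (a : C) : f t <> 0%C ->
  is_derive_C f t a -> is_derive_C (fun s => / f s)%C t (- a * / (f t * f t))%C.
Proof.
intros h0 [h1 h2]. rewrite Cinv_mult_self by assumption.
pose proof (Csq_neq0 _ h0) as hn.
assert (hn' : Im (f t) ^ 2 + Re (f t) ^ 2 <> 0) by now rewrite Rplus_comm.
split.
- pose proof (is_derive_quot_sq _ _ _ _ _ hn h1 h2) as h.
  match goal with |- is_derive _ _ ?v => replace v with ((Re a * (Im (f t) ^ 2 - Re (f t) ^ 2) - 2 * Re (f t) * Im (f t) * Im a)
     / (Re (f t) ^ 2 + Im (f t) ^ 2) ^ 2) end; [exact h|].
  unfold Re, Im in *. cbn [Cmult Copp fst snd]. field. exact hn.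
- pose proof (is_derive_quot_sq _ _ _ _ _ hn' h2 h1) as h.
  apply (is_derive_opp (V := R_NormedModule)) in h.
  apply (is_derive_ext (fun s => - (Im (f s) / (Im (f s) ^ 2 + Re (f s) ^ 2)))).
  { intros s. unfold Cinv, Re, Im. cbn [fst snd]. unfold Rdiv. rewrite Rplus_comm.
    symmetry. apply Ropp_mult_distr_l_reverse. }
  match goal with |- is_derive _ _ ?v => replace v with (- ((Im a * (Re (f t) ^ 2 - Im (f t) ^ 2) - 2 * Im (f t) * Re (f t) * Re a)
     / (Im (f t) ^ 2 + Re (f t) ^ 2) ^ 2)) end; [exact h|].
  rewrite (Rplus_comm (Im (f t) ^ 2)).
  unfold Re, Im in *. cbn [Cmult Copp fst snd]. field. exact hn.
Qed.

Lemma continuous_C_const (c : C) (t : R) : continuous_C (fun _ => c) t.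
Proof. split; apply continuous_const. Qed.

Lemma continuous_C_minus (f g : R -> C) (t : R) :
  continuous_C f t -> continuous_C g t -> continuous_C (fun s => f s - g s)%C t.
Proof.
intros [h1 h2] [h3 h4]. split.
- exact (continuous_minus (V := R_NormedModule) _ _ _ h1 h3).
- exact (continuous_minus (V := R_NormedModule) _ _ _ h2 h4).
Qed.

Lemma continuous_C_mult (f g : R -> C) (t : R) :
  continuous_C f t -> continuous_C g t -> continuous_C (fun s => f s * g s)%C t.
Proof.
intros [h1 h2] [h3 h4]. split.
- exact (continuous_minus (V := R_NormedModule) _ _ _
    (continuous_mult (K := R_AbsRing) _ _ _ h1 h3) (continuous_mult (K := R_AbsRing) _ _ _ h2 h4)).
- exact (continuous_plus (V := R_NormedModule) _ _ _
    (continuous_mult (K := R_AbsRing) _ _ _ h1 h4) (continuous_mult (K := R_AbsRing) _ _ _ h2 h3)).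
Qed.

Lemma continuous_Cmod_sq (f : R -> C) (t : R) :
  continuous_C f t -> continuous (fun s => Re (f s) ^ 2 + Im (f s) ^ 2) t.
Proof.
intros [h1 h2].
apply (continuous_ext (fun s => Re (f s) * Re (f s) + Im (f s) * Im (f s))); [intros; cbn; ring|].
exact (continuous_plus (V := R_NormedModule) _ _ _
    (continuous_mult (K := R_AbsRing) _ _ _ h1 h1) (continuous_mult (K := R_AbsRing) _ _ _ h2 h2)).
Qed.

Lemma continuous_Cmod (f : R -> C) (t : R) :
  continuous_C f t -> continuous (fun s => Cmod (f s)) t.
Proof. intros h. now apply continuous_sqrt_comp, continuous_Cmod_sq. Qed.

Lemma continuous_C_inv (f : R -> C) (t : R) : f t <> 0%C ->
  continuous_C f t -> continuous_C (fun s => / f s)%C t.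
Proof.
intros h0 h. pose proof (continuous_Cmod_sq f t h) as hn. pose proof (Csq_neq0 _ h0) as h1.
pose proof (continuous_Rinv_comp _ _ hn h1) as hi. split.
- exact (continuous_mult (K := R_AbsRing) _ _ _ (proj1 h) hi).
- exact (continuous_mult (K := R_AbsRing) _ _ _ (continuous_opp (V := R_NormedModule) _ _ (proj2 h)) hi).
Qed.

(** The complex derivative of [moebius b] at [z], multiplied by the tangent vector [v]. *)
Definition moebius_velocity (b z v : C) : C :=
  (v * (1 - Cconj b * b) * / ((1 - Cconj b * z) * (1 - Cconj b * z)))%C.

Lemma is_derive_C_moebius (b : C) (psi : R -> C) (t : R) (v : C) :
  (1 - Cconj b * psi t)%C <> 0%C -> is_derive_C psi t v ->
  is_derive_C (fun s => moebius b (psi s)) t (moebius_velocity b (psi t) v).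
Proof.
intros h0 h. eapply is_derive_C_eq.
- apply is_derive_C_mult.
  + apply is_derive_C_minus; [exact h|apply is_derive_C_const].
  + apply is_derive_C_inv; [exact h0|].
    apply is_derive_C_minus; [apply is_derive_C_const|].
    apply is_derive_C_mult; [apply is_derive_C_const|exact h].
- unfold moebius_velocity. field. assumption.
Qed.

(** The derivative and 1 - |moebius b z|^2 both carry the factor (1 - |b|^2) / |1 - conj(b) z|^2,
    which cancels: Moebius maps preserve the Poincare metric. *)
Lemma moebius_velocity_isometric (b z v : C) : unit_disc b -> unit_disc z ->
  Cmod (moebius_velocity b z v) / (1 - Cmod (moebius b z) ^ 2) = Cmod v / (1 - Cmod z ^ 2).
Proof.
intros hb hz. pose proof (moebius_den_neq0 b z hb hz) as h0.
pose proof (moebius_den_pos b z hb hz) as h1.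
pose proof (one_minus_pseudo_dist_sq b z hb hz) as h2.
pose proof (one_minus_sq_pos b hb). pose proof (one_minus_sq_pos z hz).
unfold moebius_velocity. rewrite !Cmod_mult, Cmod_inv, Cmod_mult by now apply Cmult_neq_0.
unfold pseudo_dist in h2. set (m := Cmod (moebius b z)) in *. set (n := Cmod (1 - Cconj b * z)) in *.
replace (Cmod (1 - Cconj b * b)) with (1 - Cmod b ^ 2).
2:{ rewrite <- Cmod_sq_C, <- RtoC_minus, Cmod_R, Rabs_pos_eq; lra. }
replace (1 - m ^ 2) with ((1 - Cmod b ^ 2) * (1 - Cmod z ^ 2) / n ^ 2).
- field. repeat split; lra.
- rewrite <- h2. field. lra.
Qed.

(** Applying the mean value theorem to the integral of [g] minus [A] avoids integrating [a], about
    whose continuity nothing is assumed. *)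
Lemma derive_le_RInt (A a g : R -> R) :
  (forall t, 0 <= t <= 1 -> is_derive A t (a t) /\ a t <= g t /\ continuous g t) ->
  A 1 - A 0 <= RInt g 0 1.
Proof.
intros h.
(* Extending [g] by constants makes its integral differentiable at every point, the ends 0 and 1
   included. *)
set (g' := extension_C0 g 0 1).
assert (hg' : forall t, continuous g' t).
{ apply (extension_C0_continuous (V := R_NormedModule)); [cbn; lra|].
  intros t h1 h2. now apply h. }
assert (heq : forall t, 0 <= t <= 1 -> g' t = g t).
{ intros t ht. apply extension_C0_ext; cbn; lra. }
set (I := fun t => RInt g' 0 t).
assert (hI : forall t, is_derive I t (g' t)).
{ intros t. apply (is_derive_RInt g' I 0 t); [|apply hg'].
  apply filter_forall. intros s. apply (RInt_correct (V := R_CompleteNormedModule)).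
  apply (ex_RInt_continuous (V := R_CompleteNormedModule)). intros; apply hg'. }
destruct (MVT_gen (fun t => I t - A t) 0 1 (fun t => g' t - a t)) as (c & hc & e).
- intros t ht. rewrite Rmin_left, Rmax_right in ht by lra.
  apply (is_derive_minus (V := R_NormedModule) I A); [apply hI|]. apply (h t); lra.
- intros t ht. rewrite Rmin_left, Rmax_right in ht by lra.
  apply continuity_pt_filterlim, (ex_derive_continuous (V := R_NormedModule) (fun t => I t - A t)).
  exists (g' t - a t). apply (is_derive_minus (V := R_NormedModule) I A); [apply hI|].
  now apply (h t).
- rewrite Rmin_left, Rmax_right in hc by lra. rewrite heq in e by lra.
  destruct (h c hc) as (_ & hle & _).
  replace (RInt g 0 1) with (I 1).
  + assert (e0 : I 0 = 0) by apply (RInt_point (V := R_CompleteNormedModule)).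
    rewrite e0 in e. lra.
  + apply RInt_ext. rewrite Rmin_left, Rmax_right by lra. intros; apply heq. lra.
Qed.

Lemma C1_curve_is_derive (gamma : R -> C) (t : R) : C1_curve gamma ->
  is_derive_C gamma t (curve_velocity gamma t).
Proof.
intros h. destruct (h t) as (h1 & h2 & _). split; now apply Derive_correct.
Qed.

Lemma C1_curve_continuous (gamma : R -> C) (t : R) : C1_curve gamma -> continuous_C gamma t.
Proof.
intros h. destruct (C1_curve_is_derive gamma t h) as [h1 h2].
split; apply (ex_derive_continuous (V := R_NormedModule)); eexists; eassumption.
Qed.

Lemma C1_curve_velocity_continuous (gamma : R -> C) (t : R) : C1_curve gamma ->
  continuous_C (curve_velocity gamma) t.
Proof.
intros h. destruct (h t) as (_ & _ & hc). split.
- apply (continuous_comp (curve_velocity gamma) fst); [exact hc|].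
  apply (continuous_fst (U := R_UniformSpace) (V := R_UniformSpace)).
- apply (continuous_comp (curve_velocity gamma) snd); [exact hc|].
  apply (continuous_snd (U := R_UniformSpace) (V := R_UniformSpace)).
Qed.

Lemma unit_rotation (z : C) : exists e : C, Cmod e <= 1 /\ (e * z)%C = RtoC (Cmod z).
Proof.
destruct (Ceq_dec z 0) as [->|hz].
- exists 0%C. rewrite Cmod_0, Cmult_0_l. split; [lra|reflexivity].
- pose proof (proj1 (Cmod_gt_0 z) hz) as h0.
  assert (h1 : RtoC (Cmod z) <> 0%C) by (apply RtoC_neq0; lra).
  exists (Cconj z / Cmod z)%C. split.
  + rewrite Cmod_div, Cmod_conj, Cmod_R, Rabs_pos_eq by (auto; lra). right. field. lra.
  + replace (Cconj z / Cmod z * z)%C with ((Cconj z * z) / Cmod z)%C by (field; assumption).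
    rewrite <- Cmod_sq_C. rewrite RtoC_pow. cbn. field. assumption.
Qed.

(** After moving [z] to 0, the natural function to differentiate is the modulus of the curve, which
    is not smooth at 0. It is replaced by the real part [q] of the curve rotated so that its end
    point is a nonnegative real: [q] is differentiable, is dominated by the modulus, and agrees with
    it at both ends. *)
Lemma disc_dist_le_length (z w : C) (gamma : R -> C) : unit_disc z ->
  C1_path_in_disc z w gamma -> disc_dist z w <= poincare_length gamma.
Proof.
intros hz (hC1 & hd & e0 & e1).
destruct (unit_rotation (moebius z w)) as (e & he & hew).
set (Q := fun t => moebius z (gamma t)).
set (V := fun t => moebius_velocity z (gamma t) (curve_velocity gamma t)).
set (q := fun t => Re (e * Q t)).
assert (hre : forall u : C, Rabs (Re (e * u)) <= Cmod u).
{ intros u. eapply Rle_trans; [apply Rabs_Re_le|].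
  rewrite Cmod_mult. pose proof (Cmod_ge_0 u). nra. }
assert (hq0 : q 0 = 0).
{ unfold q, Q. rewrite e0, moebius_self, Cmult_0_r. reflexivity. }
assert (hq1 : q 1 = pseudo_dist z w).
{ unfold q, Q. rewrite e1, hew. reflexivity. }
unfold poincare_length.
replace (disc_dist z w) with (ln ((1 + q 1) / (1 - q 1)) - ln ((1 + q 0) / (1 - q 0))).
2:{ rewrite hq0, hq1. replace ((1 + 0) / (1 - 0)) with 1 by field. rewrite ln_1.
    unfold disc_dist. ring. }
apply (derive_le_RInt (fun t => ln ((1 + q t) / (1 - q t)))
  (fun t => 2 * Re (e * V t) / (1 - q t ^ 2))).
intros t ht. specialize (hd t ht).
assert (hQ : unit_disc (Q t)) by now apply moebius_disc.
pose proof (hre (Q t)) as hqQ. fold (q t) in hqQ. unfold unit_disc in hQ.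
assert (hqb : -1 < q t < 1) by (apply Rabs_le_between in hqQ; lra).
assert (hdq : is_derive q t (Re (e * V t))).
{ assert (h : is_derive_C (fun s => e * Q s)%C t (0 * Q t + e * V t)%C).
  { apply is_derive_C_mult; [apply is_derive_C_const|].
    apply is_derive_C_moebius; [now apply moebius_den_neq0|].
    now apply C1_curve_is_derive. }
  destruct h as [h _]. replace (0 * Q t + e * V t)%C with (e * V t)%C in h by ring. exact h. }
assert (hQ2 : 0 < 1 - Cmod (Q t) ^ 2) by now apply one_minus_sq_pos.
assert (hq2 : q t ^ 2 <= Cmod (Q t) ^ 2).
{ rewrite <- (pow2_abs (q t)). apply pow_incr. split; [apply Rabs_pos|assumption]. }
split; [|split].
- pose proof (is_derive_unique _ _ _ hdq) as eq.
  assert (hex : ex_derive q t) by (eexists; exact hdq).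
  auto_derive.
  + repeat split; auto; [lra|]. apply Rdiv_lt_0_compat; lra.
  + change (fun x : R => q x) with q. rewrite eq. field. repeat split; lra.
- unfold Rdiv at 2. rewrite Rmult_assoc. fold (Cmod (curve_velocity gamma t) / (1 - Cmod (gamma t) ^ 2)).
  rewrite <- (moebius_velocity_isometric z (gamma t)) by assumption.
  fold (Q t) (V t). unfold Rdiv. rewrite Rmult_assoc. apply Rmult_le_compat_l; [lra|].
  pose proof (hre (V t)) as hV. apply Rabs_le_between in hV. pose proof (Cmod_ge_0 (V t)).
  apply (Rle_trans _ (Cmod (V t) * / (1 - q t ^ 2))).
  + apply Rmult_le_compat_r; [left; apply Rinv_0_lt_compat|]; lra.
  + apply Rmult_le_compat_l; [lra|]. apply Rinv_le_contravar; lra.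
- pose proof (one_minus_sq_pos _ hd) as h2.
  apply (continuous_mult (K := R_AbsRing)).
  + apply (continuous_mult (K := R_AbsRing)); [apply continuous_const|].
    apply continuous_Cmod. now apply C1_curve_velocity_continuous.
  + apply continuous_Rinv_comp; [|lra].
    apply (continuous_ext (fun s => 1 - (Re (gamma s) ^ 2 + Im (gamma s) ^ 2))).
    { intros s. now rewrite Cmod_sq. }
    apply (continuous_minus (V := R_NormedModule)); [apply continuous_const|].
    apply continuous_Cmod_sq. now apply C1_curve_continuous.
Qed.

Lemma continuous_C_pair (psi : R -> C) (t : R) : continuous_C psi t -> continuous psi t.
Proof.
intros [h1 h2]. apply filterlim_locally. intros eps.
pose proof (proj1 (filterlim_locally _ _) h1 eps) as k1.
pose proof (proj1 (filterlim_locally _ _) h2 eps) as k2.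
generalize (filter_and _ _ k1 k2). apply filter_imp. intros s hs. exact hs.
Qed.

(* The sine runs through the geodesic from [z] to [w] without leaving the disc
   for any value of the parameter. *)
Definition geodesic (z w : C) (t : R) : C := moebius (- z) (sin (PI / 2 * t) * moebius z w).

Definition geodesic_velocity (z w : C) (t : R) : C :=
  moebius_velocity (- z) (sin (PI / 2 * t) * moebius z w)
    (PI / 2 * cos (PI / 2 * t) * moebius z w).

Lemma sin_mult_disc (s : R) (z : C) : unit_disc z -> unit_disc (sin s * z).
Proof.
unfold unit_disc. intros hz. rewrite Cmod_mult, Cmod_R. pose proof (Cmod_ge_0 z).
pose proof (SIN_bound s). assert (Rabs (sin s) <= 1) by (apply Rabs_le; lra). nra.
Qed.

Lemma is_derive_C_geodesic (z w : C) (t : R) : unit_disc z -> unit_disc w ->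
  is_derive_C (geodesic z w) t (geodesic_velocity z w t).
Proof.
intros hz hw. assert (hW := moebius_disc z w hz hw).
apply (is_derive_C_moebius (- z) (fun t => sin (PI / 2 * t) * moebius z w)%C).
- apply moebius_den_neq0; [now apply unit_disc_opp|now apply sin_mult_disc].
- eapply is_derive_C_eq.
  + apply is_derive_C_mult; [|apply is_derive_C_const].
    assert (h : is_derive_C (fun s => RtoC (sin (PI / 2 * s))) t (RtoC (PI / 2 * cos (PI / 2 * t)))).
    { split; cbn; [auto_derive; auto; ring|apply (is_derive_const (V := R_NormedModule))]. }
    exact h.
  + rewrite RtoC_mult. unfold Rdiv. rewrite RtoC_mult, RtoC_inv by lra. unfold Cdiv. ring.
Qed.

Lemma geodesic_velocity_eq (z w : C) (t : R) : unit_disc z -> unit_disc w ->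
  curve_velocity (geodesic z w) t = geodesic_velocity z w t.
Proof.
intros hz hw. destruct (is_derive_C_geodesic z w t hz hw) as [h1 h2].
rewrite (surjective_pairing (geodesic_velocity z w t)). unfold curve_velocity.
f_equal; now apply is_derive_unique.
Qed.

Lemma continuous_C_RtoC (f : R -> R) (t : R) : continuous f t -> continuous_C (fun s => RtoC (f s)) t.
Proof. intros h. split; [exact h|apply continuous_const]. Qed.

Lemma geodesic_path (z w : C) : unit_disc z -> unit_disc w -> C1_path_in_disc z w (geodesic z w).
Proof.
intros hz hw. assert (hW := moebius_disc z w hz hw).
assert (hz' := unit_disc_opp z hz).
split; [|split; [|split]].
- intros t. destruct (is_derive_C_geodesic z w t hz hw) as [h1 h2].
  split; [eexists; exact h1|]. split; [eexists; exact h2|].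
  apply (continuous_ext (geodesic_velocity z w)).
  { intros s. symmetry. now apply geodesic_velocity_eq. }
  apply continuous_C_pair.
  assert (hs : continuous_C (fun s => RtoC (sin (PI / 2 * s))) t).
  { apply continuous_C_RtoC, (ex_derive_continuous (V := R_NormedModule)). auto_derive. exact I. }
  assert (hc : continuous_C (fun s => RtoC (cos (PI / 2 * s))) t).
  { apply continuous_C_RtoC, (ex_derive_continuous (V := R_NormedModule)). auto_derive. exact I. }
  unfold geodesic_velocity, moebius_velocity.
  apply continuous_C_mult.
  + repeat first [exact hs | exact hc | apply continuous_C_const | apply continuous_C_mult].
  + apply continuous_C_inv.
    * apply Cmult_neq_0; apply moebius_den_neq0; auto using sin_mult_disc.
    * repeat first [exact hs | apply continuous_C_const | apply continuous_C_mult | apply continuous_C_minus].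
- intros t _. apply moebius_disc; auto using sin_mult_disc.
- unfold geodesic. rewrite Rmult_0_r, sin_0, Cmult_0_l. apply moebius_opp_0.
- unfold geodesic. rewrite Rmult_1_r, sin_PI2, Cmult_1_l. now apply moebiusK.
Qed.

(** By Moebius invariance the curve can be measured on a radius, where its modulus on [0, 1] is [q].
    Since the cosine is nonnegative there, the integrand is exactly the derivative of [A]. *)
Lemma geodesic_length (z w : C) : unit_disc z -> unit_disc w ->
  poincare_length (geodesic z w) = disc_dist z w.
Proof.
intros hz hw. assert (hW := moebius_disc z w hz hw).
assert (hz' := unit_disc_opp z hz).
set (rho := pseudo_dist z w). assert (hr1 : rho < 1) by exact hW.
assert (hr0 : 0 <= rho) by apply pseudo_dist_ge0.
set (q := fun t => sin (PI / 2 * t) * rho).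
assert (hq : forall t, -1 < q t < 1).
{ intros t. unfold q. pose proof (SIN_bound (PI / 2 * t)). nra. }
set (a := fun t => 2 * (PI / 2 * cos (PI / 2 * t) * rho) / (1 - q t ^ 2)).
set (A := fun t => ln ((1 + q t) / (1 - q t))).
assert (hint : is_RInt a 0 1 (A 1 - A 0)).
{ apply (is_RInt_derive (V := R_CompleteNormedModule) A a).
  - intros t _. pose proof (hq t) as h. unfold A, a. unfold q in *. auto_derive.
    + repeat split; auto; [lra|]. apply Rdiv_lt_0_compat; lra.
    + field. repeat split; try lra. nra.
  - intros t _. pose proof (hq t) as h. apply (ex_derive_continuous (V := R_NormedModule)).
    unfold a, q in *. auto_derive. repeat split; auto. nra. }
unfold poincare_length. apply is_RInt_unique.
replace (disc_dist z w) with (A 1 - A 0).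
2:{ unfold A, q. rewrite Rmult_0_r, Rmult_1_r, sin_0, sin_PI2, Rmult_0_l, Rmult_1_l.
    replace ((1 + 0) / (1 - 0)) with 1 by field. rewrite ln_1. unfold disc_dist. fold rho. ring. }
apply (is_RInt_ext a); [|exact hint].
rewrite Rmin_left, Rmax_right by lra. intros t ht.
rewrite geodesic_velocity_eq by assumption.
unfold Rdiv at 1. rewrite Rmult_assoc.
change (a t = 2 * (Cmod (geodesic_velocity z w t) / (1 - Cmod (geodesic z w t) ^ 2))).
unfold geodesic_velocity, geodesic.
rewrite moebius_velocity_isometric by auto using sin_mult_disc.
pose proof PI_RGT_0.
assert (hc : 0 <= cos (PI / 2 * t)) by (apply cos_ge_0; nra).
replace (PI / 2 * cos (PI / 2 * t))%C with (RtoC (PI / 2 * cos (PI / 2 * t))).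
2:{ rewrite RtoC_mult. unfold Rdiv. rewrite RtoC_mult, RtoC_inv by lra. reflexivity. }
rewrite !Cmod_mult, !Cmod_R. fold (pseudo_dist z w). fold rho.
rewrite (Rabs_pos_eq (PI / 2 * cos (PI / 2 * t))) by nra.
rewrite Rpow_mult_distr, pow2_abs.
unfold a, q. rewrite Rpow_mult_distr. unfold Rdiv. ring.
Qed.

Lemma poincare_dist_eq (z w : C) : unit_disc z -> unit_disc w ->
  poincare_dist z w = disc_dist z w.
Proof.
intros hz hw. unfold poincare_dist.
rewrite (is_glb_Rbar_unique _ (Finite (disc_dist z w))); [reflexivity|]. split.
- intros l (gamma & hg & ->). cbn. now apply disc_dist_le_length.
- intros b hb. apply (hb (disc_dist z w)). exists (geodesic z w).
  split; [now apply geodesic_path|]. symmetry. now apply geodesic_length.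
Qed.

(** * Local quasiconformality *)

Definition open_set (O : C -> Prop) : Prop :=
  forall z, O z -> exists d, 0 < d /\ forall x, Cmod (x - z) < d -> O x.

Lemma unit_disc_open : open_set unit_disc.
Proof.
intros z hz. exists (1 - Cmod z). unfold unit_disc in *. split; [lra|].
intros x hx. pose proof (Cmod_le_sub x z). lra.
Qed.

Lemma continuous_C_R_nbhd (v : C -> R) (z : C) (eps : R) : continuous v z -> 0 < eps ->
  exists d, 0 < d /\ forall x : C, Rabs (Re x - Re z) < d -> Rabs (Im x - Im z) < d ->
    Rabs (v x - v z) < eps.
Proof.
intros hv heps.
destruct (proj1 (filterlim_locally v (v z)) hv (mkposreal eps heps)) as (d & hd).
exists d. split; [apply cond_pos|]. intros x h1 h2. apply (hd x). split; assumption.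
Qed.

Lemma MVT_segment (f f' : R -> R) (a b : R) :
  (forall s, Rmin a b <= s <= Rmax a b -> is_derive f s (f' s)) ->
  exists c, Rmin a b <= c <= Rmax a b /\ f b - f a = f' c * (b - a).
Proof.
intros h. apply MVT_gen.
- intros s hs. apply h. lra.
- intros s hs. apply continuity_pt_filterlim, (ex_derive_continuous (V := R_NormedModule)).
  exists (f' s). now apply h.
Qed.

Lemma between_near (a b z c d : R) : Rabs (a - z) < d -> Rabs (b - z) < d ->
  Rmin a b <= c <= Rmax a b -> Rabs (c - z) < d.
Proof.
intros h1 h2 h3. apply Rabs_def2 in h1, h2. apply Rabs_def1;
 unfold Rmin, Rmax in h3; destruct (Rle_dec a b); lra.
Qed.

(** Strict differentiability: both points vary, while the partial derivatives are taken at [z]. The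
    points are joined by a vertical and a horizontal segment, with the mean value theorem on each;
    the halved radius [d3 / 2] keeps this broken path inside [O]. *)
Lemma C1_real_strict_diff (O : C -> Prop) (u : C -> R) (z : C) (eps : R) :
  open_set O -> C1_real_on O u -> O z -> 0 < eps ->
  exists d, 0 < d /\ forall x p : C, Cmod (x - z) < d -> Cmod (p - z) < d ->
    Rabs (u x - u p - (partial_x u z * Re (x - p) + partial_y u z * Im (x - p)))
     <= eps * Cmod (x - p).
Proof.
intros hO hu hz heps.
destruct (hu z hz) as (_ & hcx & hcy).
destruct (continuous_C_R_nbhd _ _ (eps / 2) hcx ltac:(lra)) as (d1 & hd1 & h1).
destruct (continuous_C_R_nbhd _ _ (eps / 2) hcy ltac:(lra)) as (d2 & hd2 & h2).
destruct (hO z hz) as (d3 & hd3 & h3).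
exists (Rmin d1 (Rmin d2 (d3 / 2))). split; [repeat apply Rmin_glb_lt; lra|].
intros x p hx hp.
apply Rmin_Rgt in hx, hp. destruct hx as [hx1 hx], hp as [hp1 hp].
apply Rmin_Rgt in hx, hp. destruct hx as [hx2 hx3], hp as [hp2 hp3].
pose proof (Rabs_Re_le (x - z)) as hxr. pose proof (Rabs_Im_le (x - z)) as hxi.
pose proof (Rabs_Re_le (p - z)) as hpr. pose proof (Rabs_Im_le (p - z)) as hpi.
change (Re (x - z)%C) with (Re x - Re z) in hxr. change (Im (x - z)%C) with (Im x - Im z) in hxi.
change (Re (p - z)%C) with (Re p - Re z) in hpr. change (Im (p - z)%C) with (Im p - Im z) in hpi.
assert (hin : forall w : C, Rabs (Re w - Re z) < d3 / 2 -> Rabs (Im w - Im z) < d3 / 2 -> O w).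
{ intros w hr hi. apply h3. pose proof (Cmod_le_Rabs_sum (w - z)) as hw.
  change (Re (w - z)%C) with (Re w - Re z) in hw. change (Im (w - z)%C) with (Im w - Im z) in hw. lra. }
destruct (MVT_segment (fun s => u (s, Im x)) (fun s => partial_x u (s, Im x)) (Re p) (Re x))
  as (c & hc & e1).
{ intros s hs. apply Derive_correct. apply (hu (s, Im x)). apply hin; cbn.
  - apply (between_near (Re p) (Re x)); lra.
  - lra. }
destruct (MVT_segment (fun s => u (Re p, s)) (fun s => partial_y u (Re p, s)) (Im p) (Im x))
  as (c' & hc' & e2).
{ intros s hs. apply Derive_correct. apply (hu (Re p, s)). apply hin; cbn.
  - lra.
  - apply (between_near (Im p) (Im x)); lra. }
assert (a1 : Rabs (partial_x u (c, Im x) - partial_x u z) < eps / 2).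
{ apply h1; cbn; [apply (between_near (Re p) (Re x))|]; lra. }
assert (a2 : Rabs (partial_y u (Re p, c') - partial_y u z) < eps / 2).
{ apply h2; cbn; [|apply (between_near (Im p) (Im x))]; lra. }
replace (u (Re x, Im x)) with (u x) in e1 by now destruct x.
replace (u (Re p, Im p)) with (u p) in e2 by now destruct p.
change (Re (x - p)%C) with (Re x - Re p). change (Im (x - p)%C) with (Im x - Im p).
replace (u x - u p - (partial_x u z * (Re x - Re p) + partial_y u z * (Im x - Im p)))
 with ((partial_x u (c, Im x) - partial_x u z) * (Re x - Re p) +
       (partial_y u (Re p, c') - partial_y u z) * (Im x - Im p)) by lra.
pose proof (Rabs_Re_le (x - p)) as b1. pose proof (Rabs_Im_le (x - p)) as b2.
change (Re (x - p)%C) with (Re x - Re p) in b1. change (Im (x - p)%C) with (Im x - Im p) in b2.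
eapply Rle_trans; [apply Rabs_triang|]. rewrite !Rabs_mult.
apply (Rle_trans _ (eps / 2 * Cmod (x - p) + eps / 2 * Cmod (x - p))); [|lra].
apply Rplus_le_compat; apply Rmult_le_compat; try apply Rabs_pos; lra.
Qed.

(** The number [lam] plays the role of the largest stretch of the differential at [z], and
    [kappa * lam] that of a lower bound for the smallest. At a critical point [lam = 0] and the
    lower bound is void. *)
Definition locally_qc (kappa : R) (F : C -> C) (z : C) : Prop :=
  exists lam, 0 <= lam /\ forall eps, 0 < eps -> exists d, 0 < d /\
    forall x p, Cmod (x - z) < d -> Cmod (p - z) < d ->
      Cmod (x - p) * (kappa * lam - eps) <= Cmod (F x - F p) <= Cmod (x - p) * (lam + eps).

(** In this form the two terms of the differential have moduli |f_zeta| |h| and |f_zetabar| |h|, so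
    its stretch lies between the difference and the sum of the two derivatives. *)
Lemma wirtinger_linear (f : C -> C) (z h : C) :
  (d_zeta f z * h + d_zetabar f z * Cconj h)%C =
  (Cpartial_x f z * Re h + Cpartial_y f z * Im h)%C.
Proof.
unfold d_zeta, d_zetabar. set (a := Cpartial_x f z). set (b := Cpartial_y f z).
destruct a as [a1 a2], b as [b1 b2], h as [x y].
unfold Cconj, Cdiv, Cmult, Cplus, Cminus, Copp, Ci, RtoC, Cinv. cbn. f_equal; field.
Qed.

Lemma quasiconformal_locally_qc (O : C -> Prop) (k : R) (f : C -> C) (z : C) :
  open_set O -> 0 <= k < 1 -> quasiconformal_on O k f -> O z ->
  locally_qc ((1 - k) / (1 + k)) f z.
Proof.
intros hO hk [[hre him] hqc] hz.
set (a := Cmod (d_zeta f z)). set (b := Cmod (d_zetabar f z)).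
assert (hb : b <= k * a) by now apply hqc.
assert (ha : 0 <= a) by apply Cmod_ge_0. assert (hb0 : 0 <= b) by apply Cmod_ge_0.
exists (a + b). split; [lra|]. intros eps heps.
destruct (C1_real_strict_diff O _ z (eps / 2) hO hre hz ltac:(lra)) as (d1 & hd1 & h1).
destruct (C1_real_strict_diff O _ z (eps / 2) hO him hz ltac:(lra)) as (d2 & hd2 & h2).
exists (Rmin d1 d2). split; [now apply Rmin_glb_lt|].
intros x p hx hp. apply Rmin_Rgt in hx, hp.
specialize (h1 x p ltac:(lra) ltac:(lra)). specialize (h2 x p ltac:(lra) ltac:(lra)).
set (A := (d_zeta f z * (x - p) + d_zetabar f z * Cconj (x - p))%C).
assert (hA : Cmod (f x - f p - A) <= eps * Cmod (x - p)).
{ unfold A. rewrite wirtinger_linear. eapply Rle_trans; [apply Cmod_le_Rabs_sum|].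
  replace (eps * Cmod (x - p)) with (eps / 2 * Cmod (x - p) + eps / 2 * Cmod (x - p)) by field.
  apply Rplus_le_compat.
  - eapply Rle_trans; [right|exact h1]. f_equal. unfold Cpartial_x, Cpartial_y, re_part, im_part, Re, Im. cbn. ring.
  - eapply Rle_trans; [right|exact h2]. f_equal. unfold Cpartial_x, Cpartial_y, re_part, im_part, Re, Im. cbn. ring. }
assert (hA1 : Cmod A <= (a + b) * Cmod (x - p)).
{ unfold A. eapply Rle_trans; [apply Cmod_triangle|]. rewrite !Cmod_mult, Cmod_conj.
  unfold a, b. lra. }
assert (hA2 : (a - b) * Cmod (x - p) <= Cmod A).
{ pose proof (Cmod_le_sub (d_zeta f z * (x - p)) A) as h.
  replace (d_zeta f z * (x - p) - A)%C with (- (d_zetabar f z * Cconj (x - p)))%C in h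
    by (unfold A; ring).
  rewrite Cmod_opp, !Cmod_mult, Cmod_conj in h. unfold a, b. lra. }
assert (hkab : (1 - k) / (1 + k) * (a + b) <= a - b).
{ replace ((1 - k) / (1 + k) * (a + b)) with (((1 - k) * (a + b)) / (1 + k)) by (field; lra).
  apply Rle_div_l; nra. }
pose proof (Cmod_ge_0 (x - p)) as h0.
pose proof (Cmod_le_sub (f x - f p) A) as t1.
pose proof (Cmod_le_sub A (f x - f p)) as t2. rewrite (Cmod_minus_sym A) in t2.
split; [|lra].
assert ((1 - k) / (1 + k) * (a + b) * Cmod (x - p) <= (a - b) * Cmod (x - p))
  by (apply Rmult_le_compat_r; lra). lra.
Qed.

Lemma locally_qc_continuous (kappa : R) (F : C -> C) (z : C) : locally_qc kappa F z ->
  forall eps, 0 < eps -> exists d, 0 < d /\ forall x, Cmod (x - z) < d -> Cmod (F x - F z) < eps.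
Proof.
intros (lam & hl & h) eps heps. destruct (h 1 ltac:(lra)) as (d & hd & h').
exists (Rmin d (eps / (lam + 1))). split.
{ apply Rmin_glb_lt; [lra|]. apply Rdiv_lt_0_compat; lra. }
intros x hx. apply Rmin_Rgt in hx. destruct hx as [h1 h2].
destruct (h' x z h1) as [_ h3].
{ replace (z - z)%C with (RtoC 0) by ring. rewrite Cmod_0. lra. }
apply Rlt_div_r in h2; lra.
Qed.

Lemma locally_qc_comp (k1 k2 : R) (F G : C -> C) (z : C) :
  0 <= k1 -> 0 <= k2 -> locally_qc k1 G z -> locally_qc k2 F (G z) ->
  locally_qc (k1 * k2) (fun x => F (G x)) z.
Proof.
intros hk1 hk2 hG hF. pose proof (locally_qc_continuous _ _ _ hG) as hc.
destruct hG as (a & ha & hG). destruct hF as (b & hb & hF).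
exists (a * b). split; [nra|]. intros eps heps.
(* With [e <= 1], the products of the stretch bounds of [F] and [G] differ from [a * b] and
   [k1 * a * (k2 * b)] by at most [e * m]. *)
set (m := 1 + a + b + k1 * a + k2 * b).
assert (hm : 0 < m) by (unfold m; nra).
set (e := Rmin 1 (eps / m)).
assert (he : 0 < e) by (apply Rmin_glb_lt; [lra|]; now apply Rdiv_lt_0_compat).
assert (he1 : e <= 1) by apply Rmin_l.
assert (hem : e * m <= eps).
{ apply Rle_div_r; [lra|]. apply Rmin_r. }
destruct (hG e he) as (d1 & hd1 & h1). destruct (hF e he) as (d2 & hd2 & h2).
destruct (hc d2 hd2) as (d3 & hd3 & h3).
exists (Rmin d1 d3). split; [now apply Rmin_glb_lt|].
intros x p hx hp. apply Rmin_Rgt in hx, hp.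
specialize (h1 x p ltac:(lra) ltac:(lra)).
specialize (h2 (G x) (G p) (h3 x ltac:(lra)) (h3 p ltac:(lra))).
pose proof (Cmod_ge_0 (x - p)) as n0. pose proof (Cmod_ge_0 (G x - G p)) as n1.
pose proof (Cmod_ge_0 (F (G x) - F (G p))) as n2.
assert (p1 : 0 <= k1 * a) by nra. assert (p2 : 0 <= k2 * b) by nra.
split.
(* Lower bounds can be multiplied only if that of [F] is nonnegative. Otherwise [k2 * b < e], and
   the bound to be proved is at most 0. *)
- destruct (Rle_dec 0 (k2 * b - e)) as [h|h].
  + apply (Rle_trans _ (Cmod (x - p) * (k1 * a - e) * (k2 * b - e))).
    * rewrite (Rmult_assoc (Cmod (x - p))). apply Rmult_le_compat_l; [lra|]. unfold m in hem. nra.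
    * eapply Rle_trans; [|apply h2]. apply Rmult_le_compat_r; lra.
  + apply (Rle_trans _ 0); [|lra].
    assert (k1 * k2 * (a * b) - eps <= 0) by (unfold m in hem; nra). nra.
- apply (Rle_trans _ (Cmod (x - p) * (a + e) * (b + e))).
  + eapply Rle_trans; [apply h2|]. apply Rmult_le_compat_r; lra.
  + rewrite (Rmult_assoc (Cmod (x - p))). apply Rmult_le_compat_l; [lra|]. unfold m in hem. nra.
Qed.

(** The identity [hform] is exact: a Moebius map multiplies the distance of two points by
    [D x * D p], where [D] squared is the modulus of its derivative. Continuity of [D] is then
    enough, and conformality shows as the constant 1. *)
Lemma moebius_locally_qc (b z : C) : unit_disc b -> unit_disc z ->
  locally_qc 1 (moebius b) z.
Proof.
intros hb hz. set (c := sqrt (1 - Cmod b ^ 2)).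
pose proof (one_minus_sq_pos b hb) as hc2.
set (D := fun x => c / Cmod (1 - Cconj b * x)).
assert (hc : 0 < c) by now apply sqrt_lt_R0.
assert (hform : forall x p, unit_disc x -> unit_disc p ->
   Cmod (moebius b x - moebius b p) = Cmod (x - p) * (D x * D p)).
{ intros x p hx hp. rewrite moebius_sub by assumption.
  pose proof (moebius_den_pos b x hb hx). pose proof (moebius_den_pos b p hb hp).
  rewrite Cmod_div, !Cmod_mult.
  2:{ apply Cmult_neq_0; now apply moebius_den_neq0. }
  replace (Cmod (1 - Cconj b * b)) with (c * c).
  - unfold D. field. lra.
  - unfold c. rewrite sqrt_sqrt by lra. rewrite <- Cmod_sq_C.
    rewrite <- RtoC_minus, Cmod_R, Rabs_pos_eq; lra. }
exists (D z * D z).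
assert (hD0 : 0 < D z) by (apply Rdiv_lt_0_compat; [lra|now apply moebius_den_pos]).
split; [nra|]. intros eps heps.
(* For [e <= D z], changing both factors by at most [e] changes their product by at most 2 e D + e^2
   <= 3 e D. *)
set (e := Rmin (D z) (eps / (3 * D z))).
assert (he : 0 < e) by (apply Rmin_glb_lt; [lra|]; apply Rdiv_lt_0_compat; lra).
assert (he1 : e <= D z) by apply Rmin_l.
assert (he2 : e * (3 * D z) <= eps) by (apply Rle_div_r; [lra|apply Rmin_r]).
assert (hcont : exists d, 0 < d /\ forall x, Cmod (x - z) < d -> Rabs (D x - D z) <= e).
{ set (m := Cmod (1 - Cconj b * z)). assert (hm : 0 < m) by now apply moebius_den_pos.
  exists (Rmin (m / 2) (e * m * m / (2 * c))). split.
  { apply Rmin_glb_lt; [lra|]. apply Rdiv_lt_0_compat; [|lra].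
    apply Rmult_lt_0_compat; [nra|lra]. }
  intros x hx. apply Rmin_Rgt in hx. destruct hx as [hx1 hx2].
  set (n := Cmod (1 - Cconj b * x)).
  assert (hb1 : Cmod b <= 1) by (unfold unit_disc in hb; lra).
  assert (hdiff : Cmod (Cconj b * (x - z)) <= Cmod (x - z)).
  { rewrite Cmod_mult, Cmod_conj. pose proof (Cmod_ge_0 (x - z)). nra. }
  assert (hnm : Rabs (n - m) <= Cmod (x - z)).
  { apply Rabs_le. pose proof (Cmod_le_sub (1 - Cconj b * x) (1 - Cconj b * z)) as h1.
    pose proof (Cmod_le_sub (1 - Cconj b * z) (1 - Cconj b * x)) as h2.
    replace ((1 - Cconj b * z) - (1 - Cconj b * x))%C with (Cconj b * (x - z))%C in h2 by ring.
    replace ((1 - Cconj b * x) - (1 - Cconj b * z))%C with (- (Cconj b * (x - z)))%C in h1 by ring.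
    rewrite Cmod_opp in h1. unfold n, m. lra. }
  pose proof hnm as hnm'. apply Rabs_le_between in hnm'.
  assert (hn : m / 2 <= n) by lra.
  unfold D. fold n m. replace (c / n - c / m) with (c * (m - n) / (n * m)) by (field; lra).
  rewrite Rabs_div, Rabs_mult, (Rabs_pos_eq c), (Rabs_pos_eq (n * m)), Rabs_minus_sym by nra.
  apply Rle_div_l; [nra|].
  apply (Rle_trans _ (c * (e * m * m / (2 * c)))).
  - apply Rmult_le_compat_l; lra.
  - replace (c * (e * m * m / (2 * c))) with (e * (m / 2 * m)) by (field; lra).
    apply Rmult_le_compat_l; [lra|]. apply Rmult_le_compat_r; lra. }
destruct hcont as (d1 & hd1 & h1). destruct (unit_disc_open z hz) as (d2 & hd2 & h2).
exists (Rmin d1 d2). split; [now apply Rmin_glb_lt|].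
intros x p hx hp. apply Rmin_Rgt in hx, hp.
rewrite hform by (apply h2; lra).
pose proof (h1 x ltac:(lra)) as hx1. pose proof (h1 p ltac:(lra)) as hp1.
apply Rabs_le_between in hx1, hp1. pose proof (Cmod_ge_0 (x - p)).
split; apply Rmult_le_compat_l; nra.
Qed.

(** * Compactness of closed discs *)

(** A Lebesgue number argument. The compactness theorem concerns squares, so a radius is also
    assigned to each centre outside the closed disc: one too small for its neighbourhood to meet the
    disc. *)
Lemma closed_disc_uniform (R0 : R) (Q : C -> R -> Prop) :
  (forall x d d', 0 < d' <= d -> Q x d -> Q x d') ->
  (forall p, Cmod p <= R0 -> exists d, 0 < d /\
     forall x, Cmod (x - p) < d -> Cmod x <= R0 -> Q x d) ->
  exists d, 0 < d /\ forall x, Cmod x <= R0 -> Q x d.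
Proof.
intros hmon hloc.
assert (H : forall p : C, exists d : posreal, forall x,
   Rabs (Re x - Re p) < d -> Rabs (Im x - Im p) < d -> Cmod x <= R0 -> Q x d).
{ intros p. assert (hsq : forall x d, Rabs (Re x - Re p) < d / 2 -> Rabs (Im x - Im p) < d / 2 ->
     Cmod (x - p) < d).
  { intros x d h1 h2. pose proof (Cmod_le_Rabs_sum (x - p)) as h.
    change (Re (x - p)%C) with (Re x - Re p) in h. change (Im (x - p)%C) with (Im x - Im p) in h. lra. }
  destruct (Rle_dec (Cmod p) R0) as [hp|hp].
  - destruct (hloc p hp) as (d & hd & h). assert (hd2 : 0 < d / 2) by lra.
    exists (mkposreal _ hd2). cbn. intros x h1 h2 hx.
    apply (hmon x d); [lra|]. apply h; auto.
  - assert (hd2 : 0 < (Cmod p - R0) / 2) by lra.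
    exists (mkposreal _ hd2). cbn. intros x h1 h2 hx. exfalso.
    pose proof (hsq x _ h1 h2). pose proof (Cmod_le_sub p x) as h.
    rewrite (Cmod_minus_sym p) in h. lra. }
apply choice in H. destruct H as (delta & hdelta).
destruct (compactness_value_2d (- R0) R0 (- R0) R0 (fun u v => delta (u, v))) as (d & hd).
exists d. split; [apply cond_pos|]. intros x hx.
pose proof (Rabs_Re_le x) as h1. pose proof (Rabs_Im_le x) as h2.
assert (h1' : Rabs (Re x) <= R0) by lra. assert (h2' : Rabs (Im x) <= R0) by lra.
apply Rabs_le_between in h1', h2'.
(* [compactness_value_2d] provides a centre only under a double negation. *)
apply NNPP. intros hn. apply (hd (Re x) (Im x) h1' h2').
intros (u & v & _ & _ & h3 & h4 & h5). apply hn.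
apply (hmon x (delta (u, v))); [split; [apply cond_pos|exact h5]|].
apply hdelta; assumption.
Qed.

Definition disc_continuous (F : C -> C) : Prop := forall z, unit_disc z ->
  forall eps, 0 < eps -> exists d, 0 < d /\ forall x, Cmod (x - z) < d -> Cmod (F x - F z) < eps.

Lemma closed_disc_image_bound (F : C -> C) (R0 : R) : R0 < 1 ->
  disc_continuous F -> (forall z, unit_disc z -> unit_disc (F z)) ->
  exists m, m < 1 /\ forall x, Cmod x <= R0 -> Cmod (F x) <= m.
Proof.
intros hR hc hF.
destruct (closed_disc_uniform R0 (fun x d => Cmod (F x) <= 1 - d)) as (d & hd & h).
- intros; lra.
- intros p hp. assert (hp' : unit_disc p) by (unfold unit_disc; lra).
  pose proof (hF p hp') as h1. unfold unit_disc in h1.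
  destruct (hc p hp' ((1 - Cmod (F p)) / 2) ltac:(lra)) as (d & hd & h).
  exists (Rmin d ((1 - Cmod (F p)) / 2)). split; [apply Rmin_glb_lt; lra|].
  intros x hx _. apply Rmin_Rgt in hx. specialize (h x ltac:(lra)).
  pose proof (Cmod_le_sub (F x) (F p)). pose proof (Rmin_r d ((1 - Cmod (F p)) / 2)). lra.
- exists (1 - d). split; [lra|assumption].
Qed.

Lemma closed_disc_locally_qc (kappa : R) (F : C -> C) (R0 eps : R) : R0 < 1 -> 0 < eps ->
  (forall z, unit_disc z -> locally_qc kappa F z) ->
  exists h, 0 < h /\ forall p, Cmod p <= R0 -> exists lam, 0 <= lam /\
    forall x, Cmod (x - p) <= h ->
      Cmod (x - p) * (kappa * lam - eps) <= Cmod (F x - F p) <= Cmod (x - p) * (lam + eps).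
Proof.
intros hR heps hqc.
apply (closed_disc_uniform R0 (fun p h => exists lam, 0 <= lam /\
    forall x, Cmod (x - p) <= h ->
      Cmod (x - p) * (kappa * lam - eps) <= Cmod (F x - F p) <= Cmod (x - p) * (lam + eps))).
- intros p d d' hd (lam & hl & h). exists lam. split; [assumption|].
  intros x hx. apply h. lra.
- intros z hz. destruct (hqc z) as (lam & hl & h); [unfold unit_disc; lra|].
  destruct (h eps heps) as (d & hd & h'). exists (d / 2). split; [lra|].
  intros p hp _. exists lam. split; [assumption|]. intros x hx. apply h'; [|lra].
  pose proof (Cmod_sub_triangle x p z). lra.
Qed.

(** * Packing of squares *)

Definition lsum {A : Type} (f : A -> R) (l : list A) : R :=
  fold_right (fun a s => f a + s) 0 l.

Lemma lsum_cons {A} (f : A -> R) a l : lsum f (a :: l) = f a + lsum f l.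
Proof. reflexivity. Qed.

Lemma lsum_nil {A} (f : A -> R) : lsum f nil = 0.
Proof. reflexivity. Qed.

Lemma lsum_le {A} (f g : A -> R) l : (forall a, In a l -> f a <= g a) -> lsum f l <= lsum g l.
Proof.
induction l as [|a l IH]; cbn; intros h; [lra|].
apply Rplus_le_compat; [apply h | apply IH; intros b hb; apply h]; auto.
Qed.

Lemma lsum_ext {A} (f g : A -> R) l : (forall a, In a l -> f a = g a) -> lsum f l = lsum g l.
Proof.
intros h. apply Rle_antisym; apply lsum_le; intros a ha; rewrite (h a ha); lra.
Qed.

Lemma lsum_plus {A} (f g : A -> R) l : lsum (fun a => f a + g a) l = lsum f l + lsum g l.
Proof. induction l as [|a l IH]; cbn [map app]; [rewrite ?lsum_nil; lra|]. rewrite ?lsum_cons, IH; lra. Qed.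

Lemma lsum_scal {A} (c : R) (f : A -> R) l : lsum (fun a => c * f a) l = c * lsum f l.
Proof. induction l as [|a l IH]; cbn [map app]; [rewrite ?lsum_nil; lra|]. rewrite ?lsum_cons, IH; lra. Qed.

Lemma lsum_const {A} (c : R) (l : list A) : lsum (fun _ => c) l = INR (length l) * c.
Proof. induction l as [|a l IH]; [rewrite lsum_nil; cbn; lra|]. cbn [length]. rewrite lsum_cons, IH, S_INR; lra. Qed.

Lemma lsum_app {A} (f : A -> R) l l' : lsum f (l ++ l') = lsum f l + lsum f l'.
Proof. induction l as [|a l IH]; cbn [map app]; [rewrite ?lsum_nil; lra|]. rewrite ?lsum_cons, IH; lra. Qed.

Lemma lsum_map {A B} (f : B -> R) (g : A -> B) l : lsum f (map g l) = lsum (fun a => f (g a)) l.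
Proof. induction l as [|a l IH]; cbn [map app]; [rewrite ?lsum_nil; lra|]. rewrite ?lsum_cons, IH; lra. Qed.

Lemma lsum_prod {A B} (f : A * B -> R) l l' :
  lsum f (list_prod l l') = lsum (fun a => lsum (fun b => f (a, b)) l') l.
Proof.
induction l as [|a l IH]; cbn [list_prod]; [reflexivity|]. now rewrite lsum_app, lsum_map, IH, lsum_cons.
Qed.

Definition ind (a b x : R) : R :=
  if Rlt_dec a x then if Rlt_dec x b then 1 else 0 else 0.

Lemma is_RInt_ind (a b : R) : -1 <= a <= b -> b <= 1 -> is_RInt (ind a b) (-1) 1 (b - a).
Proof.
intros [h1 h2] h3.
assert (H : forall u v c, u <= v -> (forall x, u < x < v -> ind a b x = c) ->
          is_RInt (ind a b) u v ((v - u) * c)).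
{ intros u v c huv h. apply (is_RInt_ext (fun _ => c)).
  - rewrite Rmin_left, Rmax_right by lra. intros x hx. symmetry. now apply h.
  - apply (is_RInt_const u v c). }
replace (b - a) with (plus (plus ((a - -1) * 0) ((b - a) * 1)) ((1 - b) * 0)).
2:{ cbn. ring. }
apply (is_RInt_Chasles (V := R_NormedModule) _ _ b);
 [apply (is_RInt_Chasles (V := R_NormedModule) _ _ a)|]; apply H; try lra;
 intros x hx; unfold ind; destruct (Rlt_dec a x); try lra; destruct (Rlt_dec x b); lra.
Qed.

Lemma is_RInt_lsum {A} (F : A -> R -> R) (I : A -> R) (a b : R) l :
  (forall i, In i l -> is_RInt (F i) a b (I i)) ->
  is_RInt (fun x => lsum (fun i => F i x) l) a b (lsum I l).
Proof.
induction l as [|i l IH]; cbn; intros h.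
- pose proof (is_RInt_const (V := R_NormedModule) a b 0) as h0.
  change (is_RInt (fun _ : R => 0) a b ((b - a) * 0)) in h0. now rewrite Rmult_0_r in h0.
- apply (is_RInt_plus (F i) (fun x => lsum (fun i => F i x) l)); auto.
Qed.

(** The weights make the lemma usable twice in the area estimate: with the indicators of the
    horizontal sides for the first integration, with the vertical side lengths for the second. *)
Lemma interval_packing {A} (w x a : A -> R) (B : R) (l : list A) :
  (forall i, In i l -> 0 <= a i /\ -1 <= x i - a i /\ x i + a i <= 1) ->
  (forall t, lsum (fun i => w i * ind (x i - a i) (x i + a i) t) l <= B) ->
  lsum (fun i => w i * (2 * a i)) l <= 2 * B.
Proof.
intros h hB.
assert (hI : is_RInt (fun t => lsum (fun i => w i * ind (x i - a i) (x i + a i) t) l)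
         (-1) 1 (lsum (fun i => w i * (2 * a i)) l)).
{ apply is_RInt_lsum. intros i hi. destruct (h i hi) as (h1 & h2 & h3).
  replace (2 * a i) with ((x i + a i) - (x i - a i)) by ring.
  apply (is_RInt_scal (V := R_NormedModule) _ _ _ (w i)). apply is_RInt_ind; lra. }
assert (hc : is_RInt (fun _ : R => B) (-1) 1 (2 * B)).
{ replace (2 * B) with ((1 - -1) * B) by ring. apply (is_RInt_const (-1) 1 B). }
apply (is_RInt_le _ _ (-1) 1 _ _) with (2 := hI) (3 := hc); [lra|]. intros t _. apply hB.
Qed.

Definition in_square (x y a : R) (p : C) : Prop := Rabs (Re p - x) < a /\ Rabs (Im p - y) < a.

Lemma ind_01 (a b t : R) : ind a b t = 0 \/ (ind a b t = 1 /\ a < t < b).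
Proof.
unfold ind. destruct (Rlt_dec a t); auto. destruct (Rlt_dec t b); auto.
Qed.

Lemma lsum_excl {A} (f : A -> R) (l : list A) : NoDup l ->
  (forall i, In i l -> f i = 0 \/ f i = 1) ->
  (forall i j, In i l -> In j l -> f i = 1 -> f j = 1 -> i = j) ->
  lsum f l <= 1.
Proof.
induction l as [|i l IH]; cbn [In]; intros hn h01 hd; [rewrite lsum_nil; lra|].
rewrite lsum_cons. inversion hn as [|? ? hi hl]; subst.
destruct (h01 i (or_introl eq_refl)) as [e|e].
- rewrite e. assert (lsum f l <= 1) by (apply IH; auto). lra.
- rewrite e. rewrite (lsum_ext _ (fun _ => 0)), lsum_const; [lra|].
  intros j hj. destruct (h01 j (or_intror hj)) as [e'|e']; auto.
  exfalso. apply hi. rewrite (hd i j); auto.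
Qed.

(** Area comparison by iterated one-dimensional integrals. Disjointness says that the products of
    indicators sum to at most 1; integrating over both coordinates gives total area at most 4, for
    squares of area 4 a^2. *)
Lemma square_packing {A} (x y a : A -> R) (l : list A) : NoDup l ->
  (forall i, In i l -> 0 <= a i /\ -1 <= x i - a i /\ x i + a i <= 1 /\
      -1 <= y i - a i /\ y i + a i <= 1) ->
  (forall i j p, In i l -> In j l -> in_square (x i) (y i) (a i) p ->
      in_square (x j) (y j) (a j) p -> i = j) ->
  lsum (fun i => a i ^ 2) l <= 1.
Proof.
intros hn hb hd.
assert (h1 : forall s, lsum (fun i => ind (x i - a i) (x i + a i) s * (2 * a i)) l <= 2 * 1).
{ intros s. apply (interval_packing _ y).
  - intros i hi. specialize (hb i hi). tauto.
  - intros t. apply lsum_excl; auto.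
    + intros i _. destruct (ind_01 (x i - a i) (x i + a i) s) as [->|[-> _]]; [lra|].
      destruct (ind_01 (y i - a i) (y i + a i) t) as [->|[-> _]]; lra.
    + assert (H : forall i, ind (x i - a i) (x i + a i) s * ind (y i - a i) (y i + a i) t = 1 ->
         in_square (x i) (y i) (a i) (s, t)).
      { intros i. destruct (ind_01 (x i - a i) (x i + a i) s) as [->|[-> ?]]; [lra|].
        destruct (ind_01 (y i - a i) (y i + a i) t) as [->|[-> ?]]; [lra|].
        intros _. split; cbn; apply Rabs_def1; lra. }
      intros i j hi hj ei ej. apply (hd i j (s, t)); auto. }
assert (h2 : lsum (fun i => 2 * a i * (2 * a i)) l <= 2 * 2).
{ apply (interval_packing _ x).
  - intros i hi. specialize (hb i hi). tauto.
  - intros s. specialize (h1 s). rewrite Rmult_1_r in h1. erewrite lsum_ext; [exact h1|].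
    intros i _. cbn. ring. }
rewrite (lsum_ext _ (fun i => 4 * a i ^ 2)), lsum_scal in h2 by (intros; ring). lra.
Qed.

Lemma NoDup_list_prod {A B} (l : list A) (l' : list B) :
  NoDup l -> NoDup l' -> NoDup (list_prod l l').
Proof.
intros hl hl'. induction l as [|a l IH]; cbn; [constructor|].
inversion hl as [|? ? ha hl1]; subst. apply NoDup_app; auto.
- apply Injective_map_NoDup; auto. now intros b b' [= ->].
- intros [x y] h1 h2. apply in_map_iff in h1. destruct h1 as (b & [= <- <-] & _).
  apply in_prod_iff in h2. tauto.
Qed.

(** * Polar grids *)

Definition cis (t : R) : C := (cos t, sin t).
Definition polar (q : C) (r t : R) : C := (q + r * cis t)%C.

Lemma Cmod_cis (t : R) : Cmod (cis t) = 1.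
Proof.
unfold Cmod, cis. cbn. apply sqrt_lem_1; try nra.
pose proof (sin2_cos2 t) as h. unfold Rsqr in h. nra.
Qed.

Lemma polar_dist (q : C) (r t : R) : 0 <= r -> Cmod (polar q r t - q) = r.
Proof.
intros hr. unfold polar. replace (q + r * cis t - q)%C with (r * cis t)%C by ring.
rewrite Cmod_mult, Cmod_cis, Cmod_R, Rabs_pos_eq; lra.
Qed.

Lemma Cmod_cis_sub (a b : R) : Cmod (cis a - cis b) = 2 * Rabs (sin ((a - b) / 2)).
Proof.
apply Rsqr_inj; [apply Cmod_ge_0| pose proof (Rabs_pos (sin ((a - b) / 2))); lra |].
rewrite !Rsqr_pow2, Cmod_sq, Rpow_mult_distr, pow2_abs.
pose proof (cos_2a_sin ((a - b) / 2)) as h.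
replace (2 * ((a - b) / 2)) with (a - b) in h by field.
rewrite cos_minus in h.
pose proof (sin2_cos2 a) as ha. pose proof (sin2_cos2 b) as hb. unfold Rsqr in *.
cbn. nra.
Qed.

Lemma sin_abs_le (x : R) : Rabs (sin x) <= Rabs x.
Proof.
assert (H : forall x, 0 <= x -> Rabs (sin x) <= x).
{ intros y hy. destruct (Req_dec y 0) as [->|h0]; [rewrite sin_0, Rabs_R0; lra|].
  apply Rabs_le. split; [|left; apply sin_lt_x; lra].
  destruct (Rle_dec y 1) as [h|h]; [|pose proof (SIN_bound y); lra].
  pose proof (sin_ge_0 y hy). pose proof PI2_1. lra. }
destruct (Rle_dec 0 x) as [h|h].
- rewrite (Rabs_pos_eq x h). now apply H.
- rewrite <- (Rabs_Ropp (sin x)), <- sin_neg, (Rabs_left x) by lra. apply H; lra.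
Qed.

Lemma Cmod_cis_sub_le (a b : R) : Cmod (cis a - cis b) <= Rabs (a - b).
Proof.
rewrite Cmod_cis_sub. pose proof (sin_abs_le ((a - b) / 2)) as h.
unfold Rdiv in h at 2. rewrite Rabs_mult, (Rabs_pos_eq (/ 2)) in h; lra.
Qed.

Lemma sin_ge_half (x : R) : 0 <= x <= 1 -> x / 2 <= sin x.
Proof.
intros [h0 h1]. destruct (Req_dec x 0) as [->|hx]; [rewrite sin_0; lra|].
destruct (MVT_cor2 sin cos 0 x) as (c & hc & hc'); [lra|intros; apply derivable_pt_lim_sin|].
rewrite sin_0 in hc. assert (1 / 2 <= cos c); [|nra].
rewrite <- cos_PI3. apply cos_decr_1; pose proof PI_4; pose proof PI2_3_2; lra.
Qed.

(** The chord is twice the sine of PI (j - i) / N, an angle between PI / N and PI - PI / N, where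
    the sine is at least its value at the ends. This includes neighbours across the angle 0. *)
Lemma cis_grid_separated (N i j : nat) : (4 <= N)%nat -> (i < j < N)%nat ->
  / INR N <= Cmod (cis (2 * PI * INR j / INR N) - cis (2 * PI * INR i / INR N)).
Proof.
intros hN hij. rewrite Cmod_cis_sub.
assert (hN' : 4 <= INR N) by (replace 4 with (INR 4) by (cbn; lra); apply le_INR; lia).
assert (h1 : INR i + 1 <= INR j) by (rewrite <- S_INR; apply le_INR; lia).
assert (h2 : INR j + 1 <= INR N) by (rewrite <- S_INR; apply le_INR; lia).
pose proof (pos_INR i) as h3. pose proof PI_4. pose proof PI2_3_2.
set (x := (2 * PI * INR j / INR N - 2 * PI * INR i / INR N) / 2).
assert (hx : x = PI * ((INR j - INR i) / INR N)) by (unfold x; field; lra).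
assert (hq : / INR N <= (INR j - INR i) / INR N <= 1 - / INR N).
{ assert (0 < / INR N) by (apply Rinv_0_lt_compat; lra). split.
  - unfold Rdiv. nra.
  - replace (1 - / INR N) with ((INR N - 1) * / INR N) by (field; lra). unfold Rdiv. nra. }
assert (hi : 0 < / INR N <= / 4) by (split; [apply Rinv_0_lt_compat|apply Rinv_le_contravar]; lra).
set (m := PI * / INR N).
assert (hm : m <= x <= PI - m) by (unfold m; rewrite hx; split; nra).
assert (hm1 : 0 < m <= 1) by (unfold m; split; nra).
assert (hs : sin m <= sin x).
{ destruct (Rle_dec x (PI / 2)).
  - apply sin_incr_1; lra.
  - rewrite <- (sin_PI_x x). apply sin_incr_1; lra. }
pose proof (sin_ge_half m ltac:(lra)). pose proof (Rle_abs (sin x)).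
unfold m in *. nra.
Qed.

Lemma polar_exists (q a : C) (r : R) : 0 < r -> Cmod (a - q) = r ->
  exists t, 0 <= t <= 2 * PI /\ a = polar q r t.
Proof.
intros hr ha. set (x := Re (a - q)). set (y := Im (a - q)).
assert (h2 : x ^ 2 + y ^ 2 = r ^ 2) by (unfold x, y; rewrite <- Cmod_sq, ha; reflexivity).
assert (hx : -1 <= x / r <= 1).
{ split; [apply Rle_div_r|apply Rle_div_l]; nra. }
assert (hxy : a = (q + (x, y))%C).
{ unfold x, y. destruct a, q. unfold Cplus, Cminus, Copp. cbn. f_equal; ring. }
assert (hs : sqrt (1 - (x / r)²) = Rabs y / r).
{ rewrite <- (Rabs_pos_eq r) at 2 by lra. unfold Rdiv at 2.
  rewrite <- Rabs_inv, <- Rabs_mult, <- sqrt_Rsqr_abs. f_equal.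
  unfold Rsqr. field_simplify; [|lra|lra]. apply (Rmult_eq_reg_r (r ^ 2)); [|nra].
  field_simplify; [|lra|lra]. nra. }
pose proof (acos_bound (x / r)) as hb.
destruct (Rle_dec 0 y) as [h|h].
- exists (acos (x / r)). split; [lra|]. rewrite hxy. unfold polar, cis.
  rewrite cos_acos, sin_acos, hs, Rabs_pos_eq by lra.
  f_equal. unfold Cmult, RtoC. cbn. f_equal; field; lra.
- exists (2 * PI - acos (x / r)). split; [lra|]. rewrite hxy. unfold polar, cis.
  rewrite cos_minus, sin_minus, cos_2PI, sin_2PI, cos_acos, sin_acos, hs, Rabs_left by lra.
  f_equal. unfold Cmult, RtoC. cbn. f_equal; field; lra.
Qed.

(** All points are compared with the one at angle 0, so two points of the circle differ in [u] by at
    most twice the sum; this is the factor 2 in [lsum_sq_lower]. *)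
Lemma circle_walk (u : C -> R) (q : C) (r : R) (N : nat) (t : nat -> R) :
  (0 < N)%nat ->
  (forall j s, (j < N)%nat -> 2 * PI * INR j / INR N <= s <= 2 * PI * INR (S j) / INR N ->
     Rabs (u (polar q r s) - u (polar q r (2 * PI * INR j / INR N))) <= t j) ->
  forall s, 0 <= s <= 2 * PI ->
    Rabs (u (polar q r s) - u (polar q r 0)) <= lsum t (seq 0 N).
Proof.
intros hN ht. pose proof PI_RGT_0 as hpi.
assert (hN' : 0 < INR N) by now apply lt_0_INR.
assert (H : forall n, (n <= N)%nat -> forall s, 0 <= s <= 2 * PI * INR n / INR N ->
    Rabs (u (polar q r s) - u (polar q r 0)) <= lsum t (seq 0 n)).
{ induction n as [|n IH]; intros hn s hs.
  - replace s with 0 by (unfold Rdiv in hs; cbn in hs; rewrite Rmult_0_r, Rmult_0_l in hs; lra).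
    cbn. rewrite Rminus_eq_0, Rabs_R0. lra.
  - rewrite seq_S, lsum_app, lsum_cons, lsum_nil. cbn [Nat.add].
    specialize (IH ltac:(lia)).
    assert (hp : 0 <= 2 * PI * INR n / INR N).
    { pose proof (pos_INR n). apply Rdiv_le_0_compat; nra. }
    destruct (Rle_dec s (2 * PI * INR n / INR N)) as [h|h].
    + pose proof (IH s ltac:(lra)).
      pose proof (ht n (2 * PI * INR n / INR N) ltac:(lia)) as h1.
      rewrite Rminus_eq_0, Rabs_R0 in h1.
      assert (0 <= t n); [apply h1|lra]. split; [lra|].
      unfold Rdiv. apply Rmult_le_compat_r; [left; now apply Rinv_0_lt_compat|].
      rewrite S_INR. nra.
    + pose proof (IH (2 * PI * INR n / INR N) ltac:(lra)) as h1.
      pose proof (ht n s ltac:(lia) ltac:(lra)) as h2.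
      pose proof (Rabs_triang (u (polar q r s) - u (polar q r (2 * PI * INR n / INR N)))
        (u (polar q r (2 * PI * INR n / INR N)) - u (polar q r 0))) as h3.
      replace (u (polar q r s) - u (polar q r (2 * PI * INR n / INR N)) +
        (u (polar q r (2 * PI * INR n / INR N)) - u (polar q r 0)))
        with (u (polar q r s) - u (polar q r 0)) in h3 by ring. lra. }
intros s hs. apply (H N (le_n N)). replace (2 * PI * INR N / INR N) with (2 * PI); [lra|].
field. lra.
Qed.

(** Cauchy-Schwarz in tangent form: t^2 >= 2 c t - c^2, with [c] the smallest mean that the
    hypothesis allows. *)
Lemma lsum_sq_lower (t : nat -> R) (N : nat) (l : R) : (0 < N)%nat -> 0 <= l ->
  l <= 2 * lsum t (seq 0 N) -> l ^ 2 / (4 * INR N) <= lsum (fun j => t j ^ 2) (seq 0 N).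
Proof.
intros hN hl h. assert (hN' : 0 < INR N) by now apply lt_0_INR.
set (c := l / (2 * INR N)).
assert (hc : 0 <= c) by (unfold c; apply Rdiv_le_0_compat; lra).
apply (Rle_trans _ (lsum (fun j => 2 * c * t j + - c ^ 2) (seq 0 N))).
- rewrite lsum_plus, lsum_scal, lsum_const, length_seq.
  replace (l ^ 2 / (4 * INR N)) with (c * l - INR N * c ^ 2) by (unfold c; field; lra).
  nra.
- apply lsum_le. intros j _. pose proof (pow2_ge_0 (t j - c)). nra.
Qed.

(** Since (1 + 1/N)^N <= e <= 3, a grid of [M * N] circles fits between radii of ratio 3^M, for
    every [N]. *)
Lemma pow_geom_le (N M i : nat) : (0 < N)%nat -> (i <= M * N)%nat ->
  (1 + / INR N) ^ i <= 3 ^ M.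
Proof.
intros hN hi. assert (hN' : 0 < INR N) by now apply lt_0_INR.
assert (h0 : 0 < / INR N) by now apply Rinv_0_lt_compat.
apply (Rle_trans _ ((1 + / INR N) ^ (N * M))).
- apply Rle_pow; [lra|lia].
- rewrite pow_mult. apply pow_incr. split; [apply pow_le; lra|].
  apply (Rle_trans _ (exp (/ INR N) ^ N)).
  + apply pow_incr. split; [lra|]. left. apply exp_ineq1. lra.
  +
    assert (H : forall n, exp (/ INR N) ^ n = exp (INR n * / INR N)).
    { induction n as [|n IH]; [cbn; now rewrite Rmult_0_l, exp_0|].
      rewrite S_INR, Rmult_plus_distr_r, exp_plus, Rmult_1_l. cbn. rewrite IH. ring. }
    rewrite H, Rinv_r by lra. apply exp_le_3.
Qed.

Lemma radii_separated (r0 : R) (N i i' : nat) : 0 < r0 -> (2 <= N)%nat -> (i < i')%nat ->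
  r0 * (1 + / INR N) ^ i / (4 * INR N) + r0 * (1 + / INR N) ^ i' / (4 * INR N)
   <= r0 * (1 + / INR N) ^ i' - r0 * (1 + / INR N) ^ i.
Proof.
intros hr hN hi. assert (hN' : 2 <= INR N) by (replace 2 with (INR 2) by reflexivity; now apply le_INR).
set (c := / INR N). assert (hc : 0 < c <= / 2).
{ split; [apply Rinv_0_lt_compat|apply Rinv_le_contravar]; lra. }
assert (h : (1 + c) * (1 + c) ^ i <= (1 + c) ^ i').
{ change ((1 + c) ^ S i <= (1 + c) ^ i'). apply Rle_pow; [lra|lia]. }
assert (h0 : 0 < (1 + c) ^ i) by (apply pow_lt; lra).
replace (r0 * (1 + c) ^ i / (4 * INR N) + r0 * (1 + c) ^ i' / (4 * INR N))
  with (r0 * (c / 4 * ((1 + c) ^ i + (1 + c) ^ i'))) by (unfold c; field; lra).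
replace (r0 * (1 + c) ^ i' - r0 * (1 + c) ^ i) with (r0 * ((1 + c) ^ i' - (1 + c) ^ i)) by ring.
apply Rmult_le_compat_l; [lra|].
generalize dependent ((1 + c) ^ i'). generalize dependent ((1 + c) ^ i). clearbody c.
intros A hA B hB.
assert ((1 + c) * A * (1 - c / 4) <= B * (1 - c / 4)) by (apply Rmult_le_compat_r; lra).
assert (0 <= A * c * (1 / 2 - c / 4)) by (apply Rmult_le_pos; nra). nra.
Qed.

(** Both the gap to the next circle and the spacing on a circle are at least r / N, so discs of
    radius r / (4 N) around grid points are disjoint. *)
Lemma polar_grid_separated (q : C) (r0 : R) (N i i' j j' : nat) (x : C) :
  0 < r0 -> (4 <= N)%nat -> (j < N)%nat -> (j' < N)%nat ->
  let r i := r0 * (1 + / INR N) ^ i in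
  Cmod (x - polar q (r i) (2 * PI * INR j / INR N)) < r i / (4 * INR N) ->
  Cmod (x - polar q (r i') (2 * PI * INR j' / INR N)) < r i' / (4 * INR N) ->
  i = i' /\ j = j'.
Proof.
intros hr hN hj hj' r hx hx'.
assert (hN' : 4 <= INR N) by (replace 4 with (INR 4) by (cbn; lra); now apply le_INR).
assert (h0 : 0 < / INR N) by (apply Rinv_0_lt_compat; lra).
assert (hri : forall i, 0 < r i) by (intros k; unfold r; apply Rmult_lt_0_compat; [lra|apply pow_lt; lra]).
assert (H1 : forall i i' j j', Cmod (x - polar q (r i) (2 * PI * INR j / INR N)) < r i / (4 * INR N) ->
  Cmod (x - polar q (r i') (2 * PI * INR j' / INR N)) < r i' / (4 * INR N) -> ~ (i < i')%nat).
{ clear - hr hN hri. intros i i' j j' hx hx' hi.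
  pose proof (radii_separated r0 N i i' hr ltac:(lia) hi) as h. fold (r i) (r i') in h.
  set (p := polar q (r i) (2 * PI * INR j / INR N)) in *.
  set (p' := polar q (r i') (2 * PI * INR j' / INR N)) in *.
  assert (e : Cmod (p - q) = r i) by (apply polar_dist; left; apply hri).
  assert (e' : Cmod (p' - q) = r i') by (apply polar_dist; left; apply hri).
  pose proof (Cmod_sub_triangle p' x q). pose proof (Cmod_sub_triangle x p q).
  rewrite (Cmod_minus_sym p' x) in *. lra. }
assert (ei : i = i').
{ pose proof (H1 i i' j j' hx hx'). pose proof (H1 i' i j' j hx' hx). lia. }
subst i'. split; [reflexivity|].
assert (H2 : forall j j', (j < j' < N)%nat ->
  Cmod (x - polar q (r i) (2 * PI * INR j / INR N)) < r i / (4 * INR N) ->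
  Cmod (x - polar q (r i) (2 * PI * INR j' / INR N)) < r i / (4 * INR N) -> False).
{ clear - hri hN hN' h0. intros j j' hj hx hx'.
  pose proof (cis_grid_separated N j j' hN hj) as h. specialize (hri i).
  pose proof (Cmod_sub_triangle (polar q (r i) (2 * PI * INR j' / INR N)) x
    (polar q (r i) (2 * PI * INR j / INR N))) as h1.
  rewrite (Cmod_minus_sym _ x) in h1.
  replace (polar q (r i) (2 * PI * INR j' / INR N) - polar q (r i) (2 * PI * INR j / INR N))%C
   with (r i * (cis (2 * PI * INR j' / INR N) - cis (2 * PI * INR j / INR N)))%C in h1
   by (unfold polar; ring).
  rewrite Cmod_mult, Cmod_R, Rabs_pos_eq in h1 by lra.
  replace (r i / (4 * INR N)) with (r i * / INR N / 4) in * by (field; lra). nra. }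
destruct (Nat.lt_trichotomy j j') as [h|[h|h]]; auto; exfalso.
- now apply (H2 j j').
- now apply (H2 j' j).
Qed.

(** * The length-area inequality *)

Lemma in_square_dist (c : C) (a : R) (p : C) : in_square (Re c) (Im c) a p ->
  Cmod (p - c) < 2 * a.
Proof.
intros [h1 h2]. assert (ha : 0 < a) by (pose proof (Rabs_pos (Re p - Re c)); lra).
apply pow2_lt_reg; [lra|]. rewrite Cmod_sq.
replace (Re (p - c)%C) with (Re p - Re c) by reflexivity.
replace (Im (p - c)%C) with (Im p - Im c) by reflexivity.
rewrite <- (pow2_abs (Re p - Re c)), <- (pow2_abs (Im p - Im c)).
pose proof (Rabs_pos (Re p - Re c)). pose proof (Rabs_pos (Im p - Im c)). nra.
Qed.

Lemma square_in_unit_disc_bounds (c : C) (a : R) : 0 < a ->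
  (forall y, Cmod (y - c) < 2 * a -> Cmod y < 1) ->
  -1 <= Re c - a /\ Re c + a <= 1 /\ -1 <= Im c - a /\ Im c + a <= 1.
Proof.
intros ha h.
assert (H : forall v : C, Cmod v = a -> Rabs (Re (c + v)%C) < 1 /\ Rabs (Im (c + v)%C) < 1).
{ intros v hv. pose proof (h (c + v)%C) as h1.
  replace (c + v - c)%C with v in h1 by ring. specialize (h1 ltac:(lra)).
  pose proof (Rmax_Cmod (c + v)%C) as h2. unfold Re, Im.
  pose proof (Rmax_l (Rabs (fst (c + v)%C)) (Rabs (snd (c + v)%C))).
  pose proof (Rmax_r (Rabs (fst (c + v)%C)) (Rabs (snd (c + v)%C))). lra. }
assert (ea : Cmod a = a) by (rewrite Cmod_R, Rabs_pos_eq; lra).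
assert (ei : Cmod (Ci * a) = a).
{ rewrite Cmod_mult, ea. replace (Cmod Ci) with 1; [ring|].
  unfold Cmod, Ci. cbn. symmetry. replace (0 * (0 * 1) + 1 * (1 * 1)) with 1 by ring. apply sqrt_1. }
destruct (H a ea) as [h1 _]. destruct (H (- a)%C ltac:(now rewrite Cmod_opp)) as [h2 _].
destruct (H (Ci * a)%C ei) as [_ h3]. destruct (H (- (Ci * a))%C ltac:(now rewrite Cmod_opp)) as [_ h4].
apply Rabs_def2 in h1, h2, h3, h4. destruct c as [x y]. cbn in *. lra.
Qed.

(* In the last hypothesis [u] stretches by at most [lam + eps] near [p], while
   [F] maps the disc of radius [rho] around [p] onto a set containing a disc of
   radius [rho * (kappa * lam - eps)]; these image discs, taken over a polar
   grid, are disjoint and lie in the unit disc. *)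
Lemma length_area (F : C -> C) (u : C -> R) (q : C) (kappa l r0 r1 : R) (M : nat) :
  0 < kappa <= 1 -> 0 <= l -> 0 < r0 -> r0 * 3 ^ M <= r1 ->
  (forall x x', unit_disc x -> unit_disc x' -> F x = F x' -> x = x') ->
  (forall x, unit_disc x -> unit_disc (F x)) ->
  (forall r, r0 <= r <= r1 -> exists a b,
     Cmod (a - q) = r /\ Cmod (b - q) = r /\ l <= u a - u b) ->
  (forall eps, 0 < eps -> exists h, 0 < h /\ forall p, Cmod (p - q) <= r1 ->
     exists lam, 0 <= lam /\
      (forall x, Cmod (x - q) <= r1 -> Cmod (x - p) <= h ->
         Rabs (u x - u p) <= Cmod (x - p) * (lam + eps)) /\
      (forall rho y, 0 < rho <= h -> Cmod (y - F p) < rho * (kappa * lam - eps) ->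
         exists x, unit_disc x /\ Cmod (x - p) < rho /\ F x = y)) ->
  INR M * l ^ 2 <= 300000 / kappa ^ 2.
Proof.
intros hk hl hr0 hr1 hinj hmap hosc hloc.
assert (hr1pos : 0 < r1) by (pose proof (pow_lt 3 M ltac:(lra)); nra).
(* Chosen for the grid points with [kappa * lam < 2 * eps]: each contributes at most 1 / (kappa (M +
   1) N) to a length, so the squares over all M N^2 points add up to at most 1 / kappa^2. *)
set (eps := / (24 * r1 * (INR M + 1))).
pose proof (pos_INR M) as hM.
assert (heps : 0 < eps) by (apply Rinv_0_lt_compat; nra).
destruct (hloc eps heps) as (h & hh & hloc').
(* One angular step has length at most 2 PI r1 / N <= 8 r1 / N, which must not exceed [h]. *)
destruct (INR_unbounded (4 + 8 * r1 / h)) as (N & hN).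
assert (h8 : 0 < 8 * r1 / h) by (apply Rdiv_lt_0_compat; lra).
assert (hN4 : (4 <= N)%nat) by (apply INR_le; cbn [INR]; lra).
assert (hN' : 4 <= INR N) by lra.
assert (hNh : 8 * r1 / INR N <= h).
{ apply Rle_div_l; [lra|]. apply (Rmult_le_reg_r (/ h)); [now apply Rinv_0_lt_compat|].
  replace (h * INR N * / h) with (INR N) by (field; lra). unfold Rdiv in *. lra. }
clear hN.
set (r i := r0 * (1 + / INR N) ^ i).
set (p := fun ij : nat * nat => polar q (r (fst ij)) (2 * PI * INR (snd ij) / INR N)).
assert (hiN : 0 < / INR N) by (apply Rinv_0_lt_compat; lra).
assert (hrpos : forall i, 0 < r i).
{ intros i. apply Rmult_lt_0_compat; [lra|]. apply pow_lt. lra. }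
assert (hrle : forall i, (i < M * N)%nat -> r0 <= r i <= r1).
{ intros i hi. unfold r. pose proof (pow_geom_le N M i ltac:(lia) ltac:(lia)).
  pose proof (pow_R1_Rle (1 + / INR N) i ltac:(lra)). split; nra. }
assert (hpq : forall ij, Cmod (p ij - q) = r (fst ij)).
{ intros ij. apply polar_dist. left. apply hrpos. }
set (L := list_prod (seq 0 (M * N)) (seq 0 N)).
assert (hL : forall ij, In ij L -> (fst ij < M * N)%nat /\ (snd ij < N)%nat).
{ intros [i j] hij. apply in_prod_iff in hij. rewrite !in_seq in hij. cbn. lia. }
assert (hlam : exists lam : nat * nat -> R, forall ij, In ij L -> 0 <= lam ij /\
      (forall x, Cmod (x - q) <= r1 -> Cmod (x - p ij) <= h ->
         Rabs (u x - u (p ij)) <= Cmod (x - p ij) * (lam ij + eps)) /\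
      (forall rho y, 0 < rho <= h -> Cmod (y - F (p ij)) < rho * (kappa * lam ij - eps) ->
         exists x, unit_disc x /\ Cmod (x - p ij) < rho /\ F x = y)).
{ apply (choice (fun ij lam => In ij L -> 0 <= lam /\
      (forall x, Cmod (x - q) <= r1 -> Cmod (x - p ij) <= h ->
         Rabs (u x - u (p ij)) <= Cmod (x - p ij) * (lam + eps)) /\
      (forall rho y, 0 < rho <= h -> Cmod (y - F (p ij)) < rho * (kappa * lam - eps) ->
         exists x, unit_disc x /\ Cmod (x - p ij) < rho /\ F x = y))).
  intros ij. destruct (classic (In ij L)) as [hij|hij]; [|exists 0; tauto].
  destruct (hloc' (p ij)) as (lam & hlam); [|exists lam; auto].
  rewrite hpq. apply hrle. now apply hL. }
clear hloc hloc'. destruct hlam as (lam & hlam).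
(* Bounds the variation of [u] on the arc from a grid point to the next: arc length times
   stretch. *)
set (t := fun ij => 8 * r (fst ij) / INR N * (lam ij + eps)).
assert (hcirc : forall i, (i < M * N)%nat ->
   l ^ 2 / (4 * INR N) <= lsum (fun j => t (i, j) ^ 2) (seq 0 N)).
{ intros i hi. apply lsum_sq_lower; [lia|lra|].
  assert (hw := circle_walk u q (r i) N (fun j => t (i, j)) ltac:(lia)).
  destruct (hosc (r i) (hrle i hi)) as (a & b & ha & hb & hab).
  destruct (polar_exists q a (r i) (hrpos i) ha) as (sa & hsa & ea).
  destruct (polar_exists q b (r i) (hrpos i) hb) as (sb & hsb & eb).
  assert (hstep : forall j s, (j < N)%nat ->
      2 * PI * INR j / INR N <= s <= 2 * PI * INR (S j) / INR N ->
      Rabs (u (polar q (r i) s) - u (polar q (r i) (2 * PI * INR j / INR N))) <= t (i, j)).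
  { intros j s hj hs.
    assert (hij : In (i, j) L) by (apply in_prod_iff; rewrite !in_seq; lia).
    destruct (hlam _ hij) as (hl0 & hl1 & _).
    assert (hd : Cmod (polar q (r i) s - p (i, j)) <= 8 * r i / INR N).
    { unfold p, polar. cbn [fst snd].
      replace (q + r i * cis s - (q + r i * cis (2 * PI * INR j / INR N)))%C
        with (r i * (cis s - cis (2 * PI * INR j / INR N)))%C by ring.
      specialize (hrpos i). rewrite Cmod_mult, Cmod_R, Rabs_pos_eq by lra.
      pose proof (Cmod_cis_sub_le s (2 * PI * INR j / INR N)) as h1.
      rewrite Rabs_pos_eq in h1 by lra. rewrite S_INR in hs.
      replace (2 * PI * (INR j + 1) / INR N) with
         (2 * PI * INR j / INR N + 2 * PI * / INR N) in hs by (field; lra).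
      assert (h2 : 2 * PI * / INR N <= 8 * / INR N).
      { apply Rmult_le_compat_r; [lra|]. pose proof PI_4. lra. }
      replace (8 * r i / INR N) with (r i * (8 * / INR N)) by (field; lra).
      apply Rmult_le_compat_l; lra. }
    assert (hr1N : 8 * r i / INR N <= h).
    { apply (Rle_trans _ (8 * r1 / INR N)); [|assumption]. unfold Rdiv.
      apply Rmult_le_compat_r; [lra|]. destruct (hrle i hi). lra. }
    eapply Rle_trans; [apply (hl1 (polar q (r i) s))|].
    - rewrite polar_dist; [now apply hrle|left; apply hrpos].
    - lra.
    - unfold t. cbn [fst]. apply Rmult_le_compat_r; [lra|exact hd]. }
  pose proof (hw hstep sa hsa) as h1. pose proof (hw hstep sb hsb) as h2.
  rewrite <- ea in h1. rewrite <- eb in h2.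
  apply Rabs_le_between in h1, h2. lra. }
assert (hlow : INR M * l ^ 2 / 4 <= lsum (fun ij => t ij ^ 2) L).
{ unfold L. rewrite lsum_prod.
  apply (Rle_trans _ (lsum (fun _ : nat => l ^ 2 / (4 * INR N)) (seq 0 (M * N)))).
  - rewrite lsum_const, length_seq, mult_INR. right. field. lra.
  - apply lsum_le. intros i hi. apply in_seq in hi. apply hcirc. lia. }
set (rho i := r i / (4 * INR N)).
(* Half the side of a square inside the image disc of radius [2 * a ij]. Where the stretch is too
   small for the lower bound to be useful, an empty square at the origin is a harmless default. *)
set (a := fun ij => if Rle_dec (2 * eps) (kappa * lam ij)
   then rho (fst ij) * (kappa * lam ij - eps) / 2 else 0).
set (c := fun ij => if Rle_dec (2 * eps) (kappa * lam ij) then F (p ij) else RtoC 0).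
assert (hrho : forall i, (i < M * N)%nat -> 0 < rho i <= h).
{ intros i hi. pose proof (hrpos i). split; [apply Rdiv_lt_0_compat; lra|].
  apply (Rle_trans _ (8 * r1 / INR N)); [|assumption]. destruct (hrle i hi).
  unfold rho. replace (r i / (4 * INR N)) with (r i / 4 * / INR N) by (field; lra).
  unfold Rdiv at 2. apply Rmult_le_compat_r; lra. }
assert (hcov : forall ij y, In ij L -> Cmod (y - c ij) < 2 * a ij ->
   exists x, unit_disc x /\ Cmod (x - p ij) < rho (fst ij) /\ F x = y).
{ intros ij y hij. unfold a, c. destruct (Rle_dec (2 * eps) (kappa * lam ij)) as [e|e].
  - intros hy. apply (hlam ij hij); [apply hrho; now apply hL|]. lra.
  - intros hy. pose proof (Cmod_ge_0 (y - 0)). lra. }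
assert (hup : lsum (fun ij => a ij ^ 2) L <= 1).
{ apply (square_packing (fun ij => Re (c ij)) (fun ij => Im (c ij))).
  - apply NoDup_list_prod; apply seq_NoDup.
  - intros ij hij. destruct (Rle_dec (2 * eps) (kappa * lam ij)) as [e|e].
    + assert (ha : 0 < a ij).
      { unfold a. destruct (Rle_dec (2 * eps) (kappa * lam ij)); [|contradiction].
        destruct (hL ij hij) as [hi _]. pose proof (hrho _ hi). nra. }
      pose proof (square_in_unit_disc_bounds (c ij) (a ij) ha) as hb.
      assert (H : forall y, Cmod (y - c ij) < 2 * a ij -> Cmod y < 1).
      { intros y hy. destruct (hcov ij y hij hy) as (x & hx & _ & <-). now apply hmap. }
      specialize (hb H). lra.
    + unfold a, c. destruct (Rle_dec (2 * eps) (kappa * lam ij)); [contradiction|]. cbn. lra.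
  - intros ij ij' y hij hij' hy hy'. apply in_square_dist in hy, hy'.
    destruct (hcov ij y hij hy) as (x & hx & hxp & hxy).
    destruct (hcov ij' y hij' hy') as (x' & hx' & hxp' & hxy').
    assert (x' = x) by (apply hinj; congruence). subst x'.
    destruct (hL ij hij), (hL ij' hij').
    destruct (polar_grid_separated q r0 N (fst ij) (fst ij') (snd ij) (snd ij') x); auto.
    rewrite (surjective_pairing ij), (surjective_pairing ij'). congruence. }
assert (hk2 : 0 < kappa ^ 2) by nra.
assert (hpt : forall ij, In ij L ->
   t ij ^ 2 <= 65536 / kappa ^ 2 * a ij ^ 2 + / (kappa ^ 2 * (INR M + 1) * INR N ^ 2)).
{ intros ij hij. destruct (hlam ij hij) as (hl0 & _). destruct (hL ij hij) as [hi _].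
  specialize (hrpos (fst ij)). destruct (hrle (fst ij) hi) as [_ hri].
  assert (hz : 0 < / (kappa ^ 2 * (INR M + 1) * INR N ^ 2)).
  { apply Rinv_0_lt_compat. apply Rmult_lt_0_compat; nra. }
  assert (ht0 : 0 <= t ij).
  { unfold t. apply Rmult_le_pos; [|lra]. apply Rdiv_le_0_compat; lra. }
  unfold a. destruct (Rle_dec (2 * eps) (kappa * lam ij)) as [e|e].
  (* From 2 eps <= kappa lam and kappa <= 1 follows kappa (lam + eps) <= 4 (kappa lam - eps). The
     radii 8 r / N and r / (8 N) in [t] and [a] give the remaining factor 64. *)
  - assert (ht : t ij <= 256 / kappa * (rho (fst ij) * (kappa * lam ij - eps) / 2)).
    { unfold t, rho.
      replace (8 * r (fst ij) / INR N * (lam ij + eps)) with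
        (8 * r (fst ij) * / INR N * / kappa * (kappa * (lam ij + eps))) by (field; lra).
      replace (256 / kappa * (r (fst ij) / (4 * INR N) * (kappa * lam ij - eps) / 2))
       with (8 * r (fst ij) * / INR N * / kappa * (4 * (kappa * lam ij - eps))) by (field; lra).
      apply Rmult_le_compat_l; [|nra].
      assert (0 < / kappa) by (apply Rinv_0_lt_compat; lra).
      apply Rmult_le_pos; [|lra]. apply Rmult_le_pos; lra. }
    apply (Rle_trans _ ((256 / kappa * (rho (fst ij) * (kappa * lam ij - eps) / 2)) ^ 2)).
    + apply pow_incr. lra.
    + rewrite Rpow_mult_distr.
      replace ((256 / kappa) ^ 2) with (65536 / kappa ^ 2) by (field; lra). lra.
  - assert (hlk : lam ij + eps <= 3 * eps / kappa) by (apply Rle_div_r; nra).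
    assert (ht : t ij <= / (kappa * (INR M + 1) * INR N)).
    { apply (Rle_trans _ (8 * r1 / INR N * (3 * eps / kappa))).
      - unfold t. apply Rmult_le_compat; try lra.
        + apply Rdiv_le_0_compat; lra.
        + unfold Rdiv. apply Rmult_le_compat_r; lra.
      - unfold eps. right. field. lra. }
    apply (Rle_trans _ (/ (kappa * (INR M + 1) * INR N) ^ 2)).
    + rewrite <- pow_inv. apply pow_incr. lra.
    + rewrite pow_i, Rmult_0_r, Rplus_0_l by lia. apply Rinv_le_contravar.
      * apply Rmult_lt_0_compat; nra.
      * rewrite !Rpow_mult_distr. apply Rmult_le_compat_r; [nra|].
        apply Rmult_le_compat_l; nra. }
assert (hsum : lsum (fun ij => t ij ^ 2) L <= 65536 / kappa ^ 2 + / kappa ^ 2).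
{ eapply Rle_trans; [apply lsum_le, hpt|]. rewrite lsum_plus, lsum_scal, lsum_const.
  unfold L. rewrite length_prod, !length_seq, !mult_INR. fold L.
  apply Rplus_le_compat.
  - rewrite <- (Rmult_1_r (65536 / kappa ^ 2)) at 2. apply Rmult_le_compat_l; [|lra].
    apply Rdiv_le_0_compat; lra.
  - replace (INR M * INR N * INR N * / (kappa ^ 2 * (INR M + 1) * INR N ^ 2)) with
      (INR M * / (INR M + 1) * / kappa ^ 2) by (field; lra).
    rewrite <- (Rmult_1_l (/ kappa ^ 2)) at 2. apply Rmult_le_compat_r.
    + left. now apply Rinv_0_lt_compat.
    + apply Rle_div_l; lra. }
assert (0 < / kappa ^ 2) by now apply Rinv_0_lt_compat.
(* [hlow] and [hsum] give the constant 4 * 65537, which is below 300000. *)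
unfold Rdiv in *. lra.
Qed.

(** * Distortion of maps fixing the origin *)

Definition segment (a b : C) (t : R) : C := (a + t * (b - a))%C.

Lemma segment_0 (a b : C) : segment a b 0 = a.
Proof. unfold segment. ring. Qed.

Lemma segment_1 (a b : C) : segment a b 1 = b.
Proof. unfold segment. ring. Qed.

Lemma segment_sub (a b : C) (s t : R) :
  Cmod (segment a b s - segment a b t) = Rabs (s - t) * Cmod (b - a).
Proof.
rewrite <- Cmod_R, <- Cmod_mult, RtoC_minus. f_equal. unfold segment. ring.
Qed.

Lemma segment_convex (a b : C) (t : R) : 0 <= t <= 1 ->
  Cmod (segment a b t) <= (1 - t) * Cmod a + t * Cmod b.
Proof.
intros ht. replace (segment a b t) with ((1 - t)%R * a + t * b)%C.
- eapply Rle_trans; [apply Cmod_triangle|].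
  rewrite !Cmod_mult, !Cmod_R, !Rabs_pos_eq; lra.
- unfold segment. rewrite RtoC_minus. ring.
Qed.

Lemma segment_disc (a b : C) (t : R) : unit_disc a -> unit_disc b -> 0 <= t <= 1 ->
  unit_disc (segment a b t).
Proof.
unfold unit_disc. intros ha hb ht. pose proof (segment_convex a b t ht).
destruct (Rle_dec (Cmod a) (Cmod b)); nra.
Qed.

Lemma segment_ivt (G : C -> C) (a b c : C) (r : R) :
  (forall t, 0 <= t <= 1 -> forall eps, 0 < eps -> exists d, 0 < d /\ forall x,
     Cmod (x - segment a b t) < d -> Cmod (G x - G (segment a b t)) < eps) ->
  Cmod (G a - c) <= r <= Cmod (G b - c) ->
  exists t, 0 <= t <= 1 /\ Cmod (G (segment a b t) - c) = r.
Proof.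
intros hG [ha hb].
destruct (Req_dec (Cmod (G a - c)) r) as [e|hna].
{ exists 0. rewrite segment_0. split; [lra|assumption]. }
destruct (Req_dec (Cmod (G b - c)) r) as [e|hnb].
{ exists 1. rewrite segment_1. split; [lra|assumption]. }
destruct (IVT_interv (fun t => Cmod (G (segment a b t) - c) - r) 0 1) as (t & ht & e).
- intros t ht eps heps. destruct (hG t ht eps heps) as (d & hd & h).
  exists (d / (Cmod (b - a) + 1)). pose proof (Cmod_ge_0 (b - a)) as h0.
  split; [apply Rdiv_lt_0_compat; lra|].
  intros s [_ hs]. unfold dist in *. cbn in *. unfold Rdist in *.
  apply Rlt_div_r in hs; [|lra].
  specialize (h (segment a b s)). rewrite segment_sub in h.
  pose proof (Rabs_pos (s - t)). specialize (h ltac:(nra)).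
  pose proof (Cmod_le_sub (G (segment a b s) - c) (G (segment a b t) - c)) as h1.
  pose proof (Cmod_le_sub (G (segment a b t) - c) (G (segment a b s) - c)) as h2.
  replace (G (segment a b s) - c - (G (segment a b t) - c))%C
    with (G (segment a b s) - G (segment a b t))%C in h1 by ring.
  replace (G (segment a b t) - c - (G (segment a b s) - c))%C
    with (G (segment a b t) - G (segment a b s))%C in h2 by ring.
  rewrite (Cmod_minus_sym (G (segment a b t)) (G (segment a b s))) in h2.
  apply Rabs_def1; lra.
- lra.
- rewrite segment_0. lra.
- rewrite segment_1. lra.
- exists t. split; [assumption|]. lra.
Qed.

Definition qc_homeo (kappa : R) (F G : C -> C) : Prop :=
  (forall z, unit_disc z -> unit_disc (F z)) /\
  (forall w, unit_disc w -> unit_disc (G w)) /\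
  (forall z, unit_disc z -> G (F z) = z) /\
  (forall w, unit_disc w -> F (G w) = w) /\
  disc_continuous G /\
  (forall z, unit_disc z -> locally_qc kappa F z).

Lemma qc_homeo_continuous (kappa : R) (F G : C -> C) : qc_homeo kappa F G -> disc_continuous F.
Proof.
intros (_ & _ & _ & _ & _ & h) z hz. now apply (locally_qc_continuous kappa), h.
Qed.

Lemma disc_segment_ivt (G : C -> C) (a b c : C) (r : R) : disc_continuous G ->
  unit_disc a -> unit_disc b -> Cmod (G a - c) <= r <= Cmod (G b - c) ->
  exists t, 0 <= t <= 1 /\ Cmod (G (segment a b t) - c) = r.
Proof.
intros hG ha hb. apply segment_ivt. intros t ht. apply hG. now apply segment_disc.
Qed.

(* The inverse image of the segment from [F p] to [y] starts at [p] and cannot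
   cross the circle of radius [rho], where [F] moves points too far. *)
Lemma disc_image_covers (kappa : R) (F G : C -> C) (p y : C) (R1 rho s : R) :
  qc_homeo kappa F G -> 0 < rho -> Cmod p + rho <= R1 -> R1 < 1 ->
  (forall x, Cmod (x - p) <= rho -> Cmod (x - p) * s <= Cmod (F x - F p)) ->
  Cmod (y - F p) < rho * s ->
  exists x, unit_disc x /\ Cmod (x - p) < rho /\ F x = y.
Proof.
intros hqc hrho hp hR1 hlow. pose proof (qc_homeo_continuous _ _ _ hqc) as hFc.
destruct hqc as (hF & hG & hGF & hFG & hGc & _).
assert (hpd : unit_disc p) by (unfold unit_disc; lra).
assert (H : forall y, unit_disc y -> Cmod (y - F p) < rho * s ->
  exists x, unit_disc x /\ Cmod (x - p) < rho /\ F x = y).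
{ clear y. intros y hyd hy. exists (G y). split; [auto|]. split; [|auto].
  apply Rnot_le_lt. intros hn.
  destruct (disc_segment_ivt G (F p) y p rho hGc) as (t & ht & e); auto.
  { rewrite hGF by assumption. replace (p - p)%C with (RtoC 0) by ring. rewrite Cmod_0. lra. }
  pose proof (hlow (G (segment (F p) y t)) ltac:(lra)) as h.
  rewrite e, hFG in h by (apply segment_disc; auto).
  replace (segment (F p) y t - F p)%C with (segment (F p) y t - segment (F p) y 0)%C in h
    by now rewrite segment_0.
  rewrite segment_sub, Rminus_0_r, Rabs_pos_eq in h by lra.
  pose proof (Cmod_ge_0 (y - F p)). nra. }
(* A target [y] outside the unit disc is impossible: the segment from [F p] to [y] would contain a
   point of modulus strictly between [m] and 1, which by [H] is a value of [F] on the disc of radius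
   [R1], where |F| <= m. *)
intros hy. destruct (Rlt_dec (Cmod y) 1) as [hyd|hyd]; [now apply H|exfalso].
destruct (closed_disc_image_bound F R1 hR1 hFc hF) as (m & hm & hb).
pose proof (hb p ltac:(lra)) as hmp.
destruct (segment_ivt (fun x => x) (F p) y 0 ((1 + m) / 2)) as (t & ht & e).
{ intros t ht eps heps. now exists eps. }
{ rewrite !Cminus_0_r. lra. }
rewrite Cminus_0_r in e.
destruct (H (segment (F p) y t)) as (x & hx & hxp & hxy).
- unfold unit_disc. lra.
- replace (segment (F p) y t - F p)%C with (segment (F p) y t - segment (F p) y 0)%C
    by now rewrite segment_0.
  rewrite segment_sub, Rminus_0_r, Rabs_pos_eq by lra.
  pose proof (Cmod_ge_0 (y - F p)). nra.
- pose proof (Cmod_le_sub x p). pose proof (hb x ltac:(lra)) as h. rewrite hxy in h. lra.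
Qed.

Lemma qc_homeo_0 (kappa : R) (F G : C -> C) : qc_homeo kappa F G -> F 0 = 0%C -> G 0 = 0%C.
Proof.
intros (_ & _ & h & _) h0. rewrite <- h0 at 1. apply h, unit_disc_0.
Qed.

Lemma Re_mult_le_Cmod (e z : C) : Cmod e = 1 -> Rabs (Re (e * z)) <= Cmod z.
Proof.
intros he. eapply Rle_trans; [apply Rabs_Re_le|]. rewrite Cmod_mult, he. lra.
Qed.

Lemma qc_homeo_small_scale (kappa : R) : 0 < kappa <= 1 ->
  exists eps, 0 < eps < 1 /\ forall F G, qc_homeo kappa F G -> F 0 = 0%C ->
    forall w, Cmod w <= eps -> Cmod (F w) <= 1 / 2.
Proof.
intros hk. destruct (INR_unbounded (1200000 / kappa ^ 2)) as (M & hM).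
assert (h3 : 1 <= 3 ^ M) by (apply pow_R1_Rle; lra).
set (r0 := / (2 * 3 ^ M)).
assert (hr0 : 0 < r0) by (apply Rinv_0_lt_compat; lra).
assert (hr03 : r0 * 3 ^ M = 1 / 2) by (unfold r0; field; lra).
assert (hr02 : r0 <= 1 / 2) by nra.
exists r0. split; [lra|].
intros F G hqc hF0 w hw. pose proof (qc_homeo_0 _ _ _ hqc hF0) as hG0.
pose proof (qc_homeo_continuous _ _ _ hqc) as hFc. pose proof hqc as hqc'.
destruct hqc' as (hF & hG & hGF & hFG & hGc & hl).
apply Rnot_lt_le. intros hbig.
destruct (closed_disc_image_bound F (1 / 2) ltac:(lra) hFc hF) as (m & hm & hb).
pose proof (hb w ltac:(lra)) as hmw.
set (s := Cmod (F w)) in *.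
set (e := (F w / s)%C).
assert (hs0 : RtoC s <> 0%C) by (apply RtoC_neq0; lra).
assert (he : Cmod e = 1).
{ unfold e. rewrite Cmod_div by assumption. rewrite Cmod_R, Rabs_pos_eq by lra. fold s. field. lra. }
assert (hFw : F w = (s * e)%C) by (unfold e; field; assumption).
assert (hee : (Cconj e * e)%C = RtoC 1) by (rewrite <- Cmod_sq_C, he; f_equal; ring).
assert (heR : forall t : R, Re (Cconj e * (t * e)) = t).
{ intros t. replace (Cconj e * (t * e))%C with (t * (Cconj e * e))%C by ring.
  rewrite hee. cbn. ring. }
(* As [m] bounds |F| on the disc of radius 1/2, points of modulus [T > m] have preimages of modulus
   at least 1/2. *)
set (T := (1 + m) / 2).
assert (heT : forall t : R, Rabs t < 1 -> unit_disc (t * e)).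
{ intros t ht. unfold unit_disc. rewrite Cmod_mult, he, Cmod_R. lra. }
assert (hT : 0 < T < 1) by (unfold T; lra).
assert (hGT : forall t : R, Rabs t = T -> 1 / 2 <= Cmod (G (t * e)%C)).
{ intros t ht. apply Rnot_lt_le. intros hn. pose proof (hb _ (Rlt_le _ _ hn)) as h.
  rewrite hFG, Cmod_mult, he, Cmod_R, ht in h; [unfold T in h; lra|]. apply heT. lra. }
assert (hla := length_area F (fun x => Re (Cconj e * F x)) 0 kappa (1 / 2) r0 (1 / 2) M hk ltac:(lra) hr0 ltac:(lra)).
assert (hend : INR M * (1 / 2) ^ 2 <= 300000 / kappa ^ 2).
{ apply hla; clear hla.
  - intros x x' hx hx' e1. rewrite <- (hGF x hx), <- (hGF x' hx'). now f_equal.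
  - exact hF.
  (* Surrounding the segment is expressed by crossings: the circle of radius [r] meets the preimages
     of two segments, one from [F w] outwards to [T * e], the other from 0 to [- T * e]. The
     component of [F] along [e] is at least [s] at the first crossing and at most 0 at the
     second. *)
  - intros r hr.
    destruct (disc_segment_ivt G (F w) (T * e)%C 0 r hGc) as (t & ht & et).
    { apply hF. unfold unit_disc. lra. }
    { apply heT. rewrite Rabs_pos_eq; lra. }
    { rewrite !Cminus_0_r, hGF by (unfold unit_disc; lra). split; [lra|].
      pose proof (hGT T). rewrite Rabs_pos_eq in H by lra. lra. }
    destruct (disc_segment_ivt G 0 ((- T)%R * e)%C 0 r hGc) as (t' & ht' & et').
    { apply unit_disc_0. }
    { apply heT. rewrite Rabs_Ropp, Rabs_pos_eq; lra. }
    { rewrite !Cminus_0_r, hG0, Cmod_0. split; [lra|].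
      pose proof (hGT (- T)). rewrite Rabs_Ropp, Rabs_pos_eq in H by lra. lra. }
    exists (G (segment (F w) (T * e) t)), (G (segment 0 ((- T)%R * e) t')).
    split; [assumption|]. split; [assumption|].
    rewrite !hFG.
    + replace (segment (F w) (T * e) t) with ((s + t * (T - s))%R * e)%C.
      2:{ unfold segment. rewrite hFw, RtoC_plus, RtoC_mult, RtoC_minus. ring. }
      replace (segment 0 ((- T)%R * e) t') with ((- (t' * T))%R * e)%C.
      2:{ unfold segment. rewrite !RtoC_opp, RtoC_mult. ring. }
      rewrite !heR. unfold T in *. nra.
    + apply segment_disc; auto using unit_disc_0. apply heT. rewrite Rabs_Ropp, Rabs_pos_eq; lra.
    + apply segment_disc; auto.
      * apply hF. unfold unit_disc. lra.
      * apply heT. rewrite Rabs_pos_eq; lra.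
  - intros eps heps.
    destruct (closed_disc_locally_qc kappa F (1 / 2) eps ltac:(lra) heps hl) as (h & hh & hloc).
    (* The bound 1/4 keeps the discs around points of modulus at most 1/2 within radius 3/4, as
       [disc_image_covers] requires. *)
    exists (Rmin h (1 / 4)). split; [apply Rmin_glb_lt; lra|].
    pose proof (Rmin_l h (1 / 4)). pose proof (Rmin_r h (1 / 4)).
    intros p hp. rewrite Cminus_0_r in hp. destruct (hloc p hp) as (lam & hlam & hb').
    exists lam. split; [assumption|]. split.
    + intros x _ hx. eapply Rle_trans; [|apply hb'; lra].
      replace (Re (Cconj e * F x) - Re (Cconj e * F p)) with (Re (Cconj e * (F x - F p)))
        by (cbn; ring).
      apply Re_mult_le_Cmod. now rewrite Cmod_conj.
    + intros rho y hrho hy.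
      apply (disc_image_covers kappa F G p y (3 / 4) rho _ hqc) with (5 := hy); try lra.
      intros x hx. apply hb'. lra. }
clear hla. assert (hk2 : 0 < kappa ^ 2) by nra.
apply (Rmult_lt_compat_r (/ 4)) in hM; [|lra]. unfold Rdiv in *. lra.
Qed.

Lemma Rabs_Rmin_sub_le (a b c : R) : Rabs (Rmin a c - Rmin b c) <= Rabs (a - b).
Proof.
unfold Rmin. destruct (Rle_dec a c), (Rle_dec b c);
 unfold Rabs; repeat destruct Rcase_abs; lra.
Qed.

Lemma Rabs_Cmod_sub_le (x y : C) : Rabs (Cmod x - Cmod y) <= Cmod (x - y).
Proof.
apply Rabs_le. pose proof (Cmod_le_sub x y). pose proof (Cmod_le_sub y x).
rewrite (Cmod_minus_sym y) in *. lra.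
Qed.

Lemma qc_homeo_large_scale (kappa : R) : 0 < kappa <= 1 ->
  exists r, 0 <= r < 1 /\ forall F G, qc_homeo kappa F G -> F 0 = 0%C ->
    forall w, unit_disc w -> Cmod (F w) <= 1 / 2 -> Cmod w <= r.
Proof.
(* Here [l = 1 / 4], and 4800000 = 16 * 300000. *)
intros hk. destruct (INR_unbounded (4800000 / kappa ^ 2)) as (M & hM).
assert (h3 : 1 <= 3 ^ M) by (apply pow_R1_Rle; lra).
set (r0 := / 3 ^ M).
assert (hr0 : 0 < r0) by (apply Rinv_0_lt_compat; lra).
assert (hr03 : r0 * 3 ^ M = 1) by (unfold r0; field; lra).
assert (hr01 : r0 <= 1) by nra.
exists (1 - r0). split; [lra|].
intros F G hqc hF0 w hwd hFw. pose proof (qc_homeo_0 _ _ _ hqc hF0) as hG0.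
pose proof hqc as hqc'. destruct hqc' as (hF & hG & hGF & hFG & hGc & hl).
apply Rnot_lt_le. intros hw. unfold unit_disc in hwd.
set (s := Cmod w) in *. set (q := (w / s)%C).
assert (hs0 : RtoC s <> 0%C) by (apply RtoC_neq0; lra).
assert (hq : Cmod q = 1).
{ unfold q. rewrite Cmod_div by assumption. rewrite Cmod_R, Rabs_pos_eq by lra. fold s. field. lra. }
assert (hwq : Cmod (w - q) = 1 - s).
{ replace (w - q)%C with ((s - 1)%R * q)%C.
  - rewrite Cmod_mult, hq, Cmod_R, Rabs_left; lra.
  - unfold q. rewrite RtoC_minus. field. assumption. }
destruct (closed_disc_image_bound G (3 / 4) ltac:(lra) hGc hG) as (m & hm & hb).
assert (hm0 : 0 <= m).
{ pose proof (hb 0%C) as h. rewrite hG0, Cmod_0 in h. apply h. lra. }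
assert (hfar : forall x, unit_disc x -> m < Cmod x -> 3 / 4 < Cmod (F x)).
{ intros x hx hmx. apply Rnot_le_lt. intros hn. pose proof (hb _ hn) as h.
  rewrite hGF in h by assumption. lra. }
(* The circles around [q] leave the disc, so |F| is truncated at 3/4 and extended by this constant.
   Since |F| > 3/4 beyond radius [m], the function [u] is already constant before the unit circle is
   reached. *)
set (u := fun x => if Rlt_dec (Cmod x) 1 then Rmin (Cmod (F x)) (3 / 4) else 3 / 4).
assert (hufar : forall x, m < Cmod x -> u x = 3 / 4).
{ intros x hx. unfold u. destruct (Rlt_dec (Cmod x) 1) as [h|h]; [|reflexivity].
  apply Rmin_right. left. now apply hfar. }
assert (hla := length_area F u q kappa (1 / 4) r0 1 M hk ltac:(lra) hr0 ltac:(lra)).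
assert (hend : INR M * (1 / 4) ^ 2 <= 300000 / kappa ^ 2).
{ apply hla; clear hla.
  - intros x x' hx hx' e1. rewrite <- (hGF x hx), <- (hGF x' hx'). now f_equal.
  - exact hF.
  - intros r hr.
    destruct (disc_segment_ivt G (F w) 0 q r hGc) as (t & ht & et).
    { now apply hF. }
    { apply unit_disc_0. }
    { rewrite hGF, hG0 by assumption. rewrite hwq, Cmod_minus_sym, Cminus_0_r, hq. lra. }
    exists ((1 + r)%R * q)%C, (G (segment (F w) 0 t)).
    split; [|split; [assumption|]].
    + replace ((1 + r)%R * q - q)%C with (r * q)%C by (rewrite RtoC_plus; ring).
      rewrite Cmod_mult, hq, Cmod_R, Rabs_pos_eq; lra.
    + rewrite hufar by (rewrite Cmod_mult, hq, Cmod_R, Rabs_pos_eq; lra).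
      assert (hsd : unit_disc (segment (F w) 0 t)).
      { apply segment_disc; auto using unit_disc_0. }
      unfold u. destruct (Rlt_dec _ 1) as [h|h]; [|exfalso; apply h; now apply hG].
      rewrite hFG by assumption. pose proof (segment_convex (F w) 0 t ht) as hc.
      rewrite Cmod_0 in hc. pose proof (Rmin_l (Cmod (segment (F w) 0 t)) (3 / 4)).
      pose proof (Cmod_ge_0 (F w)). nra.
  (* With [R0] halfway between [m] and 1, a step of at most (1 - m) / 4 from a point within radius
     [R0] stays inside the disc, and from a point beyond it stays where [u] is constant. *)
  - intros eps heps. set (R0 := (1 + m) / 2).
    destruct (closed_disc_locally_qc kappa F R0 eps ltac:(unfold R0; lra) heps hl) as (h & hh & hloc).
    exists (Rmin h ((1 - m) / 4)). split; [apply Rmin_glb_lt; lra|].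
    pose proof (Rmin_l h ((1 - m) / 4)). pose proof (Rmin_r h ((1 - m) / 4)).
    intros p _. destruct (Rle_dec (Cmod p) R0) as [hp|hp].
    + destruct (hloc p hp) as (lam & hlam & hb').
      exists lam. split; [assumption|]. split.
      * intros x _ hx. eapply Rle_trans; [|apply hb'; lra].
        pose proof (Cmod_le_sub x p). unfold u, R0 in *.
        destruct (Rlt_dec (Cmod x) 1); [|lra]. destruct (Rlt_dec (Cmod p) 1); [|lra].
        eapply Rle_trans; [apply Rabs_Rmin_sub_le|apply Rabs_Cmod_sub_le].
      * intros rho y hrho hy.
        apply (disc_image_covers kappa F G p y (R0 + (1 - m) / 4) rho _ hqc) with (5 := hy);
          try (unfold R0 in *; lra).
        intros x hx. apply hb'. lra.
    (* [u] is constant near [p], and with [lam = 0] the covering condition is void because its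
       radius is negative. *)
    + exists 0. split; [lra|]. split.
      * intros x _ hx. pose proof (Cmod_le_sub p x) as h1. rewrite (Cmod_minus_sym p) in h1.
        unfold R0 in hp. rewrite !hufar by lra. rewrite Rminus_eq_0, Rabs_R0.
        pose proof (Cmod_ge_0 (x - p)). nra.
      * intros rho y hrho hy. exfalso. pose proof (Cmod_ge_0 (y - F p)). nra. }
clear hla. assert (hk2 : 0 < kappa ^ 2) by nra.
apply (Rmult_lt_compat_r (/ 16)) in hM; [|lra]. unfold Rdiv in *. lra.
Qed.

(** * The quasi-isometry *)

Lemma continuous_on_disc_continuous (F : C -> C) : continuous_on unit_disc F -> disc_continuous F.
Proof.
intros h z hz eps heps.
assert (heps2 : 0 < eps / 2) by lra.
destruct (proj1 (filterlim_locally F (F z)) (h z hz) (mkposreal _ heps2)) as (d & hd).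
destruct (unit_disc_open z hz) as (d' & hd' & h').
exists (Rmin d d'). split; [apply Rmin_glb_lt; [apply cond_pos|assumption]|].
intros x hx. apply Rmin_Rgt in hx.
pose proof (Rabs_Re_le (x - z)) as h1. pose proof (Rabs_Im_le (x - z)) as h2.
destruct (hd x) as [h3 h4].
- split; [apply (Rle_lt_trans _ _ _ h1)|apply (Rle_lt_trans _ _ _ h2)]; lra.
- apply h'. lra.
- pose proof (Cmod_le_Rabs_sum (F x - F z)) as h5.
  change (Rabs (Re (F x - F z)%C) < eps / 2) in h3. change (Rabs (Im (F x - F z)%C) < eps / 2) in h4.
  lra.
Qed.

Lemma disc_continuous_comp (F G : C -> C) : disc_continuous F -> disc_continuous G ->
  (forall z, unit_disc z -> unit_disc (G z)) -> disc_continuous (fun x => F (G x)).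
Proof.
intros hF hG hd z hz eps heps.
destruct (hF (G z) (hd z hz) eps heps) as (d & hd1 & h).
destruct (hG z hz d hd1) as (d' & hd' & h'). exists d'. auto.
Qed.

Lemma moebius_disc_continuous (b : C) : unit_disc b -> disc_continuous (moebius b).
Proof. intros hb z hz. now apply (locally_qc_continuous 1), moebius_locally_qc. Qed.

(** Moebius maps have constant 1 in [locally_qc], so [kappa] is unchanged. This makes the bounds
    obtained at the origin uniform over all base points. *)
Lemma qc_homeo_moebius (kappa : R) (F G : C -> C) (a b : C) : 0 <= kappa ->
  unit_disc a -> unit_disc b -> qc_homeo kappa F G ->
  qc_homeo kappa (fun x => moebius b (F (moebius (- a) x))) (fun y => moebius a (G (moebius (- b) y))).
Proof.
intros hk ha hb (hF & hG & hGF & hFG & hGc & hl).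
pose proof (unit_disc_opp a ha) as ha'. pose proof (unit_disc_opp b hb) as hb'.
repeat split.
- auto using moebius_disc.
- auto using moebius_disc.
- intros z hz. rewrite moebiusK, hGF, moebiusKV; auto using moebius_disc.
- intros w hw. rewrite moebiusK, hFG, moebiusKV; auto using moebius_disc.
- apply (disc_continuous_comp (moebius a)); auto using moebius_disc, moebius_disc_continuous.
  apply disc_continuous_comp; auto using moebius_disc, moebius_disc_continuous.
- intros z hz. replace kappa with (1 * kappa * 1) by ring.
  apply (locally_qc_comp (1 * kappa) 1 (moebius b) (fun x => F (moebius (- a) x))); [lra|lra| |].
  + apply locally_qc_comp; [lra|lra| |]; auto using moebius_locally_qc, moebius_disc.
  + apply moebius_locally_qc; auto using moebius_disc.
Qed.

Lemma qc_homeo_small_dist (kappa : R) : 0 < kappa <= 1 ->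
  exists eps, 0 < eps < 1 /\ forall F G, qc_homeo kappa F G ->
    forall z w, unit_disc z -> unit_disc w ->
    pseudo_dist z w <= eps -> pseudo_dist (F z) (F w) <= 1 / 2.
Proof.
intros hk. destruct (qc_homeo_small_scale kappa hk) as (eps & heps & h).
exists eps. split; [assumption|]. intros F G hqc z w hz hw hd.
assert (hFz : unit_disc (F z)) by now apply hqc.
pose proof (qc_homeo_moebius kappa F G z (F z) ltac:(lra) hz hFz hqc) as h1.
specialize (h _ _ h1). cbn beta in h. rewrite moebius_opp_0, moebius_self in h.
specialize (h eq_refl (moebius z w) hd). now rewrite moebiusK in h.
Qed.

(** Read through the inverse [G], this is the local hypothesis of [coarse_lipschitz] for [G], with
    step 1/2. *)
Lemma qc_homeo_large_dist (kappa : R) : 0 < kappa <= 1 ->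
  exists r, 0 <= r < 1 /\ forall F G, qc_homeo kappa F G ->
    forall z w, unit_disc z -> unit_disc w ->
    pseudo_dist (F z) (F w) <= 1 / 2 -> pseudo_dist z w <= r.
Proof.
intros hk. destruct (qc_homeo_large_scale kappa hk) as (r & hr & h).
exists r. split; [assumption|]. intros F G hqc z w hz hw hd.
assert (hFz : unit_disc (F z)) by now apply hqc.
pose proof (qc_homeo_moebius kappa F G z (F z) ltac:(lra) hz hFz hqc) as h1.
specialize (h _ _ h1). cbn beta in h. rewrite moebius_opp_0, moebius_self in h.
apply (h eq_refl (moebius z w)); [now apply moebius_disc|]. now rewrite moebiusK.
Qed.

Theorem proposition2p1 (k : R) (f : C -> C)
    (hk : 0 <= k < 1)
    (hqc : quasiconformal_on unit_disc k f)
    (hhomeo : homeomorphism_onto unit_disc unit_disc f) :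
  quasi_isometry_on unit_disc poincare_dist poincare_dist f.
Proof.
destruct hhomeo as (hf & _ & g & hg & hgc & hgf & hfg).
set (kappa := (1 - k) / (1 + k)).
assert (hkappa : 0 < kappa <= 1).
{ split; [apply Rdiv_lt_0_compat|apply Rle_div_l]; lra. }
assert (hfg' : qc_homeo kappa f g).
{ repeat split; auto using continuous_on_disc_continuous.
  intros z hz. now apply (quasiconformal_locally_qc unit_disc); auto using unit_disc_open. }
destruct (qc_homeo_small_dist kappa hkappa) as (eps & heps & hsmall).
destruct (qc_homeo_large_dist kappa hkappa) as (r & hr & hlarge).
destruct (coarse_lipschitz f eps (1 / 2) heps ltac:(lra) hf) as (l1 & c1 & hl1 & hc1 & h1).
{ intros z w. now apply (hsmall f g). }
destruct (coarse_lipschitz g (1 / 2) r ltac:(lra) hr hg) as (l2 & c2 & hl2 & hc2 & h2).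
{ intros z w hz hw hd. apply (hlarge f g hfg'); auto. now rewrite !hfg. }
(* For image points [h2] reads d(z, w) <= l2 d(f z, f w) + c2; division by [l2] produces [c2 / l2],
   and [l1 + l2] serves both inequalities. *)
exists (l1 + l2), (c1 + c2 / l2).
assert (hc : 0 < c2 / l2) by now apply Rdiv_lt_0_compat.
split; [lra|]. split; [lra|]. intros z w hz hw.
rewrite !poincare_dist_eq by auto.
pose proof (disc_dist_ge0 z w hz hw) as h0.
split.
- specialize (h2 (f z) (f w) (hf z hz) (hf w hw)). rewrite !hgf in h2 by assumption.
  apply (Rle_trans _ (/ l2 * disc_dist z w - c2 / l2)).
  + assert (/ (l1 + l2) <= / l2) by (apply Rinv_le_contravar; lra). nra.
  + apply (Rmult_le_reg_l l2); [assumption|].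
    replace (l2 * (/ l2 * disc_dist z w - c2 / l2)) with (disc_dist z w - c2) by (field; lra). lra.
- specialize (h1 z w hz hw). nra.
Qed.
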